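(* Let $n\ge1$, $\delta>0$, $\beta<n+2$, $\mu,\lambda^*\in\mathbb{R}$, and $\ell_1,\dots,\ell_n>0$, and consider $\mathcal{L}^{\delta,\beta}$ as an operator on vector fields on the periodic torus $\mathbf{T}^n=\prod_{i=1}^n[0,\ell_i]$. For every $k\in\mathbb{Z}^n$, $\lambda_1(k):=\lambda_1(\nu_k)$ is an eigenvalue of $\mathcal{L}^{\delta,\beta}$ with associated eigenvector field $\boldsymbol\phi_k^1$, and $\lambda_2(k):=\lambda_2(\nu_k)$ is an eigenvalue with associated eigenvector fields $\boldsymbol\phi_k^j$, $j=2,\dots,n$; that is, $$\mathcal{L}^{\delta,\beta}\boldsymbol\phi_k^1=\lambda_1(\nu_k)\boldsymbol\phi_k^1,\qquad \mathcal{L}^{\delta,\beta}\boldsymbol\phi_k^j=\lambda_2(\nu_k)\boldsymbol\phi_k^j\quad(j=2,\dots,n).$$ Here $$\lambda_1(\nu)=-\|\nu\|^2\Bigg(3\mu\;{}_3F_4\left(1,\tfrac52,\tfrac{n+2-\beta}{2};2,\tfrac32,\tfrac{n+4}{2},\tfrac{n+4-\beta}{2};-\tfrac14\|\nu\|^2\delta^2\right)+(\lambda^*-\mu)\;{}_1F_2\left(\tfrac{n+2-\beta}{2};\tfrac{n+2}{2},\tfrac{n+4-\beta}{2};-\tfrac14\|\nu\|^2\delta^2\right)^2\Bigg),$$ $$\lambda_2(\nu)=-\mu\|\nu\|^2\;{}_2F_3\left(1,\tfrac{n+2-\beta}{2};2,\tfrac{n+4}{2},\tfrac{n+4-\beta}{2};-\tfrac14\|\nu\|^2\delta^2\right),$$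 or equivalently, for $\nu\neq0$, $$\lambda_1(\nu)=(n+2)\mu\,c^{\delta,\beta}\int_{B_\delta(0)}\frac{(\nu\cdot w)^2}{\|\nu\|^2\|w\|^{\beta+2}}\big(\cos(\nu\cdot w)-1\big)\,dw-(\lambda^*-\mu)\left(\frac{c^{\delta,\beta}}{2}\int_{B_\delta(0)}\frac{\nu\cdot w}{\|\nu\|\,\|w\|^{\beta}}\sin(\nu\cdot w)\,dw\right)^2,$$ $$\lambda_2(\nu)=(n+2)\mu\,c^{\delta,\beta}\int_{B_\delta(0)}\frac{\nu\cdot w}{\|\nu\|^2\|w\|^{\beta+2}}\big(\sin(\nu\cdot w)-\nu\cdot w\big)\,dw.$$
   Context: For $k\in\mathbb{Z}^n$, $\nu_k=(2\pi k_1/\ell_1,\dots,2\pi k_n/\ell_n)^T$; $\zeta_k^2,\dots,\zeta_k^n\in\mathbb{R}^n$ are nonzero mutually orthogonal vectors, each orthogonal to $\nu_k$; and $$\boldsymbol\phi_k^1(x)=e^{i\nu_k\cdot x}\nu_k,\qquad \boldsymbol\phi_k^j(x)=e^{i\nu_k\cdot x}\zeta_k^j,\quad j=2,\dots,n.$$ (For $k=0$ the field $\boldsymbol\phi_0^1$ is identically zero, and the corresponding assertion is understood only as the displayed identity $\mathcal{L}^{\delta,\beta}\boldsymbol\phi_0^1=\lambda_1(\nu_0)\boldsymbol\phi_0^1$.) $B_\delta(x)$ is the ball of radius $\delta$ centered at $x$ in $\mathbb{R}^n$; $v\otimes w$ is the matrix with entries $v_iw_j$. The scaling constant is $$c^{\delta,\beta}=\left(\frac{1}{2n}\int_{B_\delta(0)}\frac{\|w\|^2}{\|w\|^\beta}\,dw\right)^{-1}=\frac{2(n+2-\beta)\Gamma\left(\frac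 n2+1\right)}{\pi^{n/2}\delta^{n+2-\beta}}.$$ The linear peridynamic operator acts on vector fields on $\mathbf{T}^n$, identified with periodic vector fields $\mathbf u$ on $\mathbb{R}^n$ (period $\ell_i$ in the $i$-th coordinate), by $$\mathcal{L}^{\delta,\beta}\mathbf{u}(x)=(n+2)\mu\,c^{\delta,\beta}\int_{B_\delta(0)}\frac{w\otimes w}{\|w\|^{\beta+2}}\big(\mathbf{u}(x+w)-\mathbf{u}(x)\big)\,dw+(\lambda^*-\mu)\frac{(c^{\delta,\beta})^2}{4}\int_{B_\delta(0)}\int_{B_\delta(0)}\frac{w}{\|w\|^\beta}\otimes\frac{q}{\|q\|^\beta}\,\mathbf{u}(x+q+w)\,dq\,dw.$$ When these integrals are not absolutely convergent they are understood in the principal value sense: $\lim_{\varepsilon\to0^+}\int_{\varepsilon<\|w\|<\delta}$, and in the double integral first the inner and then the outer integral in the same way. Generalized hypergeometric function: ${}_pF_q(a_1,\dots,a_p;b_1,\dots,b_q;z)=\sum_{k\ge0}\frac{(a_1)_k\cdots(a_p)_k}{(b_1)_k\cdots(b_q)_k}\frac{z^k}{k!}$ with $(a)_k=a(a+1)\cdots(a+k-1)$. *)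

(* Defs.v *)
From HB Require Import structures.
From mathcomp Require Import all_boot all_order all_algebra.
From mathcomp Require Import all_classical all_reals all_analysis.
From mathcomp Require Export complex.

Set Implicit Arguments.
Unset Strict Implicit.
Unset Printing Implicit Defensive.
Import Order.TTheory GRing.Theory Num.Theory.
Import numFieldNormedType.Exports.

Local Open Scope classical_set_scope.
Local Open Scope ring_scope.

Section measurable_cV.
Context {d} {T : measurableType d}.
Variable n : nat.

(** The sigma-algebra generated by the coordinates; for [T] the real line it is
    the Borel sigma-algebra of R^n. *)
Let coord : 'I_n -> 'cV[T]_n -> T := fun i v => v i ord0.

Let cV_set0 : g_sigma_preimage coord set0.
Proof. exact: sigma_algebra0. Qed.

Let cV_setC A : g_sigma_preimage coord A -> g_sigma_preimage coord (~` A).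
Proof. exact: sigma_algebraC. Qed.

Let cV_bigcup (F : (set 'cV[T]_n)^nat) :
  (forall i, g_sigma_preimage coord (F i)) ->
  g_sigma_preimage coord (\bigcup_i (F i)).
Proof. exact: sigma_algebra_bigcup. Qed.

HB.instance Definition _ := @isMeasurable.Build (measure_tuple_display d)
  'cV[T]_n (g_sigma_preimage coord) cV_set0 cV_setC cV_bigcup.

Lemma measurable_coord (i : 'I_n) :
  measurable_fun [set: 'cV[T]_n] (fun v => v i ord0).
Proof.
move=> _ Y mY; rewrite setTI; apply: sub_sigma_algebra => /=.
rewrite -bigcup_seq/=; exists i => /=; first by rewrite mem_index_enum.
by exists Y => //; rewrite setTI.
Qed.

End measurable_cV.

Lemma measurable_fun_cVP d1 d2 (T1 : measurableType d1) (T2 : measurableType d2)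
    n (f : T1 -> 'cV[T2]_n) :
  (forall i, measurable_fun setT (fun x => f x i ord0)) ->
  measurable_fun setT f.
Proof.
move=> mf.
have : g_sigma_preimage (fun i => (fun v : 'cV[T2]_n => v i ord0) \o f)
    `<=` measurable.
  apply: smallest_sub; first exact: sigma_algebra_measurable.
  move=> A; rewrite -bigcup_seq => -[i _ [B mB <-]]; exact: mf.
by rewrite g_sigma_preimage_comp => pS _ A mA; apply: pS; exists A.
Qed.

Section lebesgue_cV.
Context {R : realType}.

Definition consv n (p : measurableTypeR R * 'cV[R]_n) : 'cV[R]_n.+1 :=
  col_mx ((p.1 : R)%:M : 'cV[R]_1) p.2.

Lemma consv0 n (p : measurableTypeR R * 'cV[R]_n) : consv p ord0 ord0 = p.1.
Proof.
rewrite (_ : ord0 = @lshift 1 n ord0); last exact/val_inj.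
by apply: etrans (col_mxEu _ _ _ _) _; rewrite mxE.
Qed.

Lemma consvS n (p : measurableTypeR R * 'cV[R]_n) i :
  consv p (lift ord0 i) ord0 = p.2 i ord0.
Proof.
rewrite (_ : lift ord0 i = rshift 1 i); last exact/val_inj.
exact: col_mxEd.
Qed.

Lemma measurable_consv n : measurable_fun setT (@consv n).
Proof.
apply: measurable_fun_cVP => k; case: (unliftP ord0 k) => [j|] ->.
- rewrite (_ : (fun x => _) = (fun v : 'cV[R]_n => v j ord0) \o snd).
    by apply: measurableT_comp => //; exact: measurable_coord.
  by apply/funext => x; exact: consvS.
- rewrite (_ : (fun x => _) = fst); first exact: measurable_fst.
  by apply/funext => x; exact: consv0.
Qed.

HB.instance Definition _ n := isMeasurableFun.Build _ _ _ _ (@consv n)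
  (@measurable_consv n).

Section step.
Variables (n : nat) (m : {sigma_finite_measure set 'cV[R]_n -> \bar R}).
Local Open Scope ereal_scope.

Definition lebesgue_cV_step : set 'cV[R]_n.+1 -> \bar R :=
  pushforward (@lebesgue_measure R \x m) (@consv n).

Let step0 : lebesgue_cV_step set0 = 0.
Proof. exact: measure0. Qed.

Let step_ge0 A : 0 <= lebesgue_cV_step A.
Proof. exact: measure_ge0. Qed.

Let step_sigma_additive : semi_sigma_additive lebesgue_cV_step.
Proof.
exact: measure_semi_sigma_additive.
Qed.

HB.instance Definition _ := isMeasure.Build _ _ _ lebesgue_cV_step
  step0 step_ge0 step_sigma_additive.

Lemma lebesgue_cV_step_sigma_finite : sigma_finite setT lebesgue_cV_step.
Proof.
have [F FT mF] : sigma_finite setT (@lebesgue_measure R \x m).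
  have /sigma_finiteP[F [TF ndF Foo]] := sigma_finiteT (@lebesgue_measure R).
  have /sigma_finiteP[G [TG ndG Goo]] := sigma_finiteT m.
  exists (fun k => F k `*` G k).
    rewrite -setXTT TF TG predeqE => -[x y]; split.
      move=> [/= [i _ Fix] [k _ Gky]]; exists (maxn i k) => //; split.
      - by move: x Fix; exact/subsetPset/ndF/leq_maxl.
      - by move: y Gky; exact/subsetPset/ndG/leq_maxr.
    by move=> [k _ []/= ? ?]; split; exists k.
  move=> k; have [? ?] := Foo k; have [? ?] := Goo k.
  split; first exact: measurableX.
  by rewrite product_measure1E// lte_mul_pinfty// ge0_fin_numE.
pose uncons (v : 'cV[R]_n.+1) : measurableTypeR R * 'cV[R]_n :=
  (v ord0 ord0, \col_i v (lift ord0 i) ord0).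
have consvK : cancel (@consv n) uncons.
  move=> [x v]; rewrite /uncons consv0; congr pair.
  by apply/colP => i; rewrite mxE consvS.
have muncons : measurable_fun setT uncons.
  apply/measurable_fun_pairP; split; first exact: measurable_coord.
  apply: measurable_fun_cVP => i.
  rewrite (_ : (fun x => _) = (fun v : 'cV[R]_n.+1 => v (lift ord0 i) ord0)).
    exact: measurable_coord.
  by apply/funext => v /=; rewrite mxE.
exists (fun i => uncons @^-1` F i).
  by rewrite -preimage_bigcup -FT preimage_setT.
move=> i; have [mFi Fioo] := mF i; split.
  by rewrite -[X in measurable X]setTI; exact: muncons.
rewrite /lebesgue_cV_step /pushforward -comp_preimage.
by rewrite (_ : uncons \o _ = id) ?preimage_id//; apply/funext => p /=.
Qed.

HB.instance Definition _ := Measure_isSigmaFinite.Build _ _ _ lebesgue_cV_step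
  lebesgue_cV_step_sigma_finite.

End step.

Fixpoint lebesgue_cV n : {sigma_finite_measure set 'cV[R]_n -> \bar R} :=
  match n return {sigma_finite_measure set 'cV[R]_n -> \bar R} with
  | 0%N => \d_ (0 : 'cV[R]_0)
  | n'.+1 => lebesgue_cV_step (lebesgue_cV n')
  end.

Lemma lebesgue_cV_box n (A : 'I_n -> set R) :
  (forall i, measurable (A i)) ->
  lebesgue_cV n [set v | forall i, A i (v i ord0)] =
  (\prod_(i < n) lebesgue_measure (A i))%E.
Proof.
elim: n A => [|n IH] A mA.
  by rewrite big_ord0 /= diracE mem_set// => -[].
rewrite big_ord_recl -(IH (fun i => A (lift ord0 i)))//.
pose B := [set v : 'cV[R]_n | forall i, A (lift ord0 i) (v i ord0)].
have mB : measurable B.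
  rewrite (_ : B = \bigcap_(i in [set: 'I_n])
      ((fun v : 'cV[R]_n => v i ord0) @^-1` A (lift ord0 i))); last first.
    by apply/seteqP; split=> v h i; [move=> _|]; exact: h.
  apply: fin_bigcap_measurable => // i _.
  by rewrite -[X in measurable X]setTI; exact: measurable_coord.
rewrite -(product_measure1E (@lebesgue_measure R) (lebesgue_cV n))//=;
  last exact: (mA ord0).
rewrite /lebesgue_cV_step /pushforward; congr (product_measure1 _ _ _).
apply/seteqP; split=> p /=.
  move=> h; split; first by rewrite -consv0; exact: h.
  by move=> i; rewrite -consvS; exact: h.
move=> [h0 hS] i; case: (unliftP ord0 i) => [j|] ->.
  by rewrite consvS; exact: hS.
by rewrite consv0.
Qed.
End lebesgue_cV.

Section euclidean.
Context {R : realType} {n : nat}.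
Implicit Types (v w : 'cV[R]_n) (f : 'cV[R]_n -> R) (F : 'cV[R]_n -> 'cV[R[i]]_n).

Definition dotv v w : R := \sum_(i < n) v i ord0 * w i ord0.

(** The library norm [`|v|] on matrices is the sup norm. *)
Definition enorm v : R := Num.sqrt (dotv v v).

Definition eball (delta : R) : set 'cV[R]_n := [set w | enorm w < delta].

Definition annulus (eps delta : R) : set 'cV[R]_n :=
  [set w | eps < enorm w < delta].

Definition tensor v w : 'M[R]_n := v *m w^T.

Definition abs_convergent (delta : R) f : Prop :=
  (lebesgue_cV n).-integrable (eball delta) (EFin \o f).

Definition pv_approx (delta : R) f (eps : R) : R :=
  \int[lebesgue_cV n]_(w in annulus eps delta) f w.

(** Integral over [eball delta]: the Lebesgue integral if it converges
    absolutely, and the principal value at the origin otherwise. *)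
Definition ball_int (delta : R) f : R :=
  if `[< abs_convergent delta f >] then \int[lebesgue_cV n]_(w in eball delta) f w
  else lim (pv_approx delta f @ 0^'+).

(** [ball_int] is total; this is the condition under which its value is
    meaningful. *)
Definition ball_int_defined (delta : R) f : Prop :=
  abs_convergent delta f \/
  (forall eps, 0 < eps < delta ->
     (lebesgue_cV n).-integrable (annulus eps delta) (EFin \o f)) /\
  cvg (pv_approx delta f @ 0^'+).

(** Integration of complex vectors is componentwise, on real and imaginary
    parts. *)
Definition vball_int (delta : R) F : 'cV[R[i]]_n :=
  \col_i Complex (ball_int delta (fun w => complex.Re (F w i ord0)))
                 (ball_int delta (fun w => complex.Im (F w i ord0))).

Definition vball_int_defined (delta : R) F : Prop :=
  forall i, ball_int_defined delta (fun w => complex.Re (F w i ord0)) /\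
            ball_int_defined delta (fun w => complex.Im (F w i ord0)).

End euclidean.

Section peridynamic.
Context {R : realType} {n : nat}.
Variables (delta beta mu lam : R).
Implicit Types (u : 'cV[R]_n -> 'cV[R[i]]_n) (x w q nu : 'cV[R]_n).
Local Open Scope complex_scope.

Definition cmx m p (M : 'M[R]_(m, p)) : 'M[R[i]]_(m, p) :=
  map_mx (real_complex R) M.

Definition scaling_const : R :=
  ((2 * n%:R)^-1 * \int[lebesgue_cV n]_(w in eball delta)
     (enorm w ^+ 2 / enorm w `^ beta))^-1.

Definition first_integrand u x w : 'cV[R[i]]_n :=
  cmx ((enorm w `^ (beta + 2))^-1 *: tensor w w) *m (u (x + w) - u x).

Definition double_integrand u x w q : 'cV[R[i]]_n :=
  cmx (tensor ((enorm w `^ beta)^-1 *: w) ((enorm q `^ beta)^-1 *: q))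
    *m u (x + q + w).

Definition peridynamic_op u x : 'cV[R[i]]_n :=
  ((n%:R + 2) * mu * scaling_const)%:C *:
    vball_int delta (first_integrand u x) +
  ((lam - mu) * (scaling_const ^+ 2 / 4))%:C *:
    vball_int delta (fun w => vball_int delta (double_integrand u x w)).

Definition peridynamic_defined u x : Prop :=
  vball_int_defined delta (first_integrand u x) /\
  (forall w, eball delta w -> vball_int_defined delta (double_integrand u x w)) /\
  vball_int_defined delta (fun w => vball_int delta (double_integrand u x w)).

Definition peridynamic_eigen_eq u (l : R) : Prop :=
  forall x, peridynamic_defined u x /\ peridynamic_op u x = l%:C *: u x.

(** Vector fields on the torus are the [ell i]-periodic fields on R^n. *)
Definition periodic_field (ell : 'I_n -> R) u : Prop :=
  forall x i, u (x + ell i *: delta_mx i ord0) = u x.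

Definition peridynamic_eigenfield (ell : 'I_n -> R) u (l : R) : Prop :=
  [/\ periodic_field ell u, exists x, u x != 0 & peridynamic_eigen_eq u l].

Definition freq (ell : 'I_n -> R) (k : 'cV[int]_n) : 'cV[R]_n :=
  \col_i (2 * pi * (k i ord0)%:~R / ell i).

Definition expi (t : R) : R[i] := Complex (cos t) (sin t).

Definition fourier_mode nu (z : 'cV[R]_n) x : 'cV[R[i]]_n :=
  expi (dotv nu x) *: cmx z.

Definition poch (a : R) (k : nat) : R := \prod_(j < k) (a + j%:R).

Definition hypergeom (a b : seq R) (z : R) : R :=
  limn (series (fun k : nat =>
    (\prod_(c <- a) poch c k) / (\prod_(c <- b) poch c k)
      * (z ^+ k / (k`!)%:R))).

Let N : R := n%:R.

Definition hyp_arg nu : R := - (4^-1) * enorm nu ^+ 2 * delta ^+ 2.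

Definition lambda1 nu : R :=
  - enorm nu ^+ 2 *
  (3 * mu *
     hypergeom [:: 1; 5 / 2; (N + 2 - beta) / 2]
               [:: 2; 3 / 2; (N + 4) / 2; (N + 4 - beta) / 2] (hyp_arg nu)
   + (lam - mu) *
     hypergeom [:: (N + 2 - beta) / 2]
               [:: (N + 2) / 2; (N + 4 - beta) / 2] (hyp_arg nu) ^+ 2).

Definition lambda2 nu : R :=
  - mu * enorm nu ^+ 2 *
  hypergeom [:: 1; (N + 2 - beta) / 2]
            [:: 2; (N + 4) / 2; (N + 4 - beta) / 2] (hyp_arg nu).

Definition lambda1_integrand_cos nu w : R :=
  dotv nu w ^+ 2 / (enorm nu ^+ 2 * enorm w `^ (beta + 2))
    * (cos (dotv nu w) - 1).

Definition lambda1_integrand_sin nu w : R :=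
  dotv nu w / (enorm nu * enorm w `^ beta) * sin (dotv nu w).

Definition lambda2_integrand nu w : R :=
  dotv nu w / (enorm nu ^+ 2 * enorm w `^ (beta + 2))
    * (sin (dotv nu w) - dotv nu w).

Definition lambda1_int nu : R :=
  (N + 2) * mu * scaling_const *
    (\int[lebesgue_cV n]_(w in eball delta) lambda1_integrand_cos nu w)
  - (lam - mu) * (scaling_const / 2 *
    \int[lebesgue_cV n]_(w in eball delta) lambda1_integrand_sin nu w) ^+ 2.

Definition lambda2_int nu : R :=
  (N + 2) * mu * scaling_const *
    \int[lebesgue_cV n]_(w in eball delta) lambda2_integrand nu w.

End peridynamic.

(* Main.v *)
From HB Require Import structures.
Require Import Defs.
From mathcomp Require Import all_boot all_order all_algebra.
From mathcomp Require Import all_classical all_reals all_analysis.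
From mathcomp Require Import measurable_realfun ring lra.
Import Order.TTheory GRing.Theory Num.Theory.
Import numFieldNormedType.Exports.
Local Open Scope classical_set_scope.
Local Open Scope ring_scope.

(** On a Fourier mode, each integrand splits into an even and an odd part.  The
    odd part has zero integral over every annulus, so only the even, absolutely
    convergent part contributes to the principal value.  Expanding the sine and
    cosine of [dotv nu w] in power series reduces everything to moments over the
    ball.  Rotation invariance of Lebesgue measure (a plane rotation is a product
    of three shears) gives that the integral of [(dotv v w)^(2k) g(|w|)] is
    [|v|^(2k) M_k]; comparing the coefficients of first order in [t] after
    replacing [v] by [v + t y] yields the mixed moments, and summing these over an
    orthonormal basis yields the recursion [(2k+n) M_(k+1)(g) = (2k+1) M_k(|w|^2 g)].
    This leaves the integrals of powers of [|w|], whose ratios follow from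
    scaling, so that the volume of the unit ball never has to be computed.  The
    resulting series are the hypergeometric ones. *)

Set Implicit Arguments.
Unset Strict Implicit.
Unset Printing Implicit Defensive.

(** * Lebesgue measure on the line and the plane *)

(** The measure on column vectors is built by recursion on the dimension, as a pushforward of a
    product, so its symmetries are obtained from those of the line by iterated integration. This is
    done for nonnegative functions, where Tonelli always applies; the moments treated directly are
    therefore those of even powers, and polarization reaches the integrands of variable sign.
    Rotation invariance is used in one form only: the joint distribution of [dotv v w] and [|w|^2]
    depends on [v] through [|v|] alone.

    The assumption [beta < n + 2] enters through the single number [n + 2 - beta], the degree of
    homogeneity of the integrals of both [|w|^2/|w|^beta] and [|w|^4/|w|^(beta + 2)]. The vanishing
    of sine and of cosine minus one at the origin, to orders one and two, brings the even parts down
    to these two weights; the odd parts are one order more singular. All moments become multiples of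
    one radial integral, which is also the one in the scaling constant, and so it cancels. *)

Section line.
Context {R : realType}.
Notation leb := (@lebesgue_measure R).
Local Open Scope ereal_scope.

(** By uniqueness of Lebesgue measure: [r] times the pushforward along [phi] gives every half-open
    interval its length. *)
Lemma ge0_integral_affine (r c : R) (f : R -> \bar R) : (0 < r)%R ->
  measurable_fun [set: R] f -> (forall x, 0 <= f x) ->
  \int[leb]_x f (r * x + c)%R = (r^-1)%:E * \int[leb]_x f x.
Proof.
move=> r0 mf f0.
pose phi := fun x : measurableTypeR R => (r * x + c)%R : measurableTypeR R.
have mphi : measurable_fun setT phi.
  by apply: measurable_funD => //; exact: measurable_funM.
pose m := measure_function_pushforward__canonical__measure_function_Measure leb mphi.
have rE : \int[leb]_x f x = r%:E * \int[leb]_x f (r * x + c)%R.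
  pose k := NngNum (ltW r0).
  transitivity (\int[mscale k m]_x f x).
    apply: eq_measure_integral => A mA _ /=; apply: lebesgue_measure_unique => //.
    move=> _ [[a b] _ <-]; change (leb `]a, b] =
      r%:E * leb (phi @^-1` `]a, b])).
    rewrite (_ : phi @^-1` _ = `]((a - c) / r)%R, ((b - c) / r)%R]%classic); last first.
      apply/seteqP; split => x; rewrite /= !in_itv/= ltr_pdivrMr// ler_pdivlMr//;
        by rewrite ltrBlDr lerBrDr mulrC.
    rewrite !lebesgue_measure_itv/= !lte_fin ltr_pM2r ?invr_gt0//.
    rewrite ltrD2r; case: ifPn => _; last by rewrite mule0.
    by rewrite -!EFinB -EFinM; congr EFin; field; rewrite gt_eqF.
  rewrite ge0_integral_mscale//=; congr (_ * _).
  by rewrite ge0_integral_pushforward.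
by rewrite rE muleA -EFinM mulVf ?gt_eqF// mul1e.
Qed.

Lemma ge0_integral_translate (c : R) (f : R -> \bar R) :
  measurable_fun [set: R] f -> (forall x, 0 <= f x) ->
  \int[leb]_x f (x + c)%R = \int[leb]_x f x.
Proof.
move=> mf f0; have := @ge0_integral_affine 1 c f ltr01 mf f0.
by under eq_integral do rewrite mul1r; rewrite invr1 mul1e.
Qed.

Lemma ge0_integral_opp (f : R -> \bar R) :
  measurable_fun [set: R] f -> (forall x, 0 <= f x) ->
  \int[leb]_x f (- x)%R = \int[leb]_x f x.
Proof.
move=> mf f0.
pose phi := fun x : measurableTypeR R => (- x)%R : measurableTypeR R.
have mphi : measurable_fun setT phi by exact: measurable_funN.
pose m := measure_function_pushforward__canonical__measure_function_Measure leb mphi.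
transitivity (\int[m]_x f x); first by rewrite ge0_integral_pushforward.
by apply: eq_measure_integral => A mA _; exact: lebesgue_measureN.
Qed.

End line.

Section plane.
Context {R : realType}.
Notation leb := (@lebesgue_measure R).
Local Open Scope ereal_scope.
Implicit Type G : R * R -> \bar R.

Lemma measurable_lin2 (a b c d : R) :
  measurable_fun [set: R * R] (fun p => (a * p.1 + b * p.2, c * p.1 + d * p.2)%R).
Proof.
by apply/measurable_fun_pairP; split => /=;
  apply: measurable_funD; exact: measurable_funM.
Qed.

(** Exchanging the order of integration puts the sheared variable inside, where for fixed [y] the
    shear is a translation. *)
Lemma ge0_integral_xshear (t : R) G : measurable_fun [set: R * R] G ->
  (forall p, 0 <= G p) ->
  \int[leb]_x \int[leb]_y G (x + t * y, y)%R = \int[leb]_x \int[leb]_y G (x, y).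
Proof.
move=> mG G0.
have mS : measurable_fun [set: R * R] (fun p => G (p.1 + t * p.2, p.2)%R).
  apply: (measurableT_comp mG).
  have := measurable_lin2 1 t 0 1.
  by under eq_fun do rewrite !mul1r mul0r add0r.
apply: etrans (fubini_tonelli (m1 := leb) (m2 := leb) _ mS _) _ => [p|].
  exact: G0.
apply/esym; apply: etrans (fubini_tonelli (m1 := leb) (m2 := leb) _ mG G0) _.
apply/esym/eq_integral => y _ /=.
rewrite (ge0_integral_translate (t * y) (f := fun x => G (x, y)))//.
exact: measurableT_comp.
Qed.

Lemma ge0_integral_yshear (t : R) G : measurable_fun [set: R * R] G ->
  (forall p, 0 <= G p) ->
  \int[leb]_x \int[leb]_y G (x, y + t * x)%R = \int[leb]_x \int[leb]_y G (x, y).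
Proof.
move=> mG G0; apply: eq_integral => x _.
rewrite (ge0_integral_translate (t * x) (f := fun y => G (x, y)))//.
exact: measurableT_comp.
Qed.

(* A rotation of angle theta <> pi is the composite of three shears with
   parameters - tan (theta / 2), sin theta and - tan (theta / 2). *)
Lemma ge0_integral_rotation (c s : R) G : measurable_fun [set: R * R] G ->
  (forall p, 0 <= G p) -> (c ^+ 2 + s ^+ 2 = 1)%R -> c != (- 1)%R ->
  \int[leb]_x \int[leb]_y G (c * x - s * y, s * x + c * y)%R =
  \int[leb]_x \int[leb]_y G (x, y).
Proof.
move=> mG G0 cs1 cN1; pose t := (- (s / (1 + c)))%R.
have c1 : (1 + c != 0)%R by rewrite addrC addr_eq0.
have tE : (t * (1 + c) = - s)%R by rewrite /t; field.
have ts : (1 + t * s = c)%R.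
  apply: (mulIf c1); rewrite mulrDl mul1r mulrAC tE.
  by rewrite mulNr -expr2 -(addrK (s ^+ 2) (c ^+ 2))%R in cs1 *; lra.
apply/esym; apply: etrans (esym (ge0_integral_xshear t mG G0)) _; apply/esym.
pose G1 (p : R * R) := G (p.1 + t * p.2, p.2)%R.
have G1_0 p : 0 <= G1 p by exact: G0.
have mG1 : measurable_fun [set: R * R] G1.
  apply: (measurableT_comp mG).
  have := measurable_lin2 1 t 0 1.
  by under eq_fun do rewrite !mul1r mul0r add0r.
rewrite -[RHS](ge0_integral_yshear s mG1 G1_0).
pose G2 (p : R * R) := G1 (p.1, p.2 + s * p.1)%R.
have G2_0 p : 0 <= G2 p by exact: G0.
have mG2 : measurable_fun [set: R * R] G2.
  apply: (measurableT_comp mG1).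
  have := measurable_lin2 1 0 s 1.
  by under eq_fun do rewrite !mul1r mul0r addr0 [(s * _ + _)%R]addrC.
rewrite -[RHS](ge0_integral_xshear t mG2 G2_0).
apply: eq_integral => x _; apply: eq_integral => y _.
rewrite /G2 /G1 /=; congr (G (_, _)); last by rewrite -ts; ring.
have -> : (x + t * y + t * (y + s * (x + t * y)) =
  (1 + t * s) * x + (t * (1 + (1 + t * s))) * y)%R by ring.
by rewrite ts tE mulNr.
Qed.

(** The rotation with cosine [a / r] and sine [- b / r], where [r] is the length of [(a, b)],
    carries [(a, b)] to [(r, 0)] and preserves [x^2 + y^2]. *)
Lemma ge0_integral_plane_iso (F : R -> R -> \bar R) (a b : R) :
  measurable_fun [set: R * R] (fun p => F p.1 p.2) -> (forall p q, 0 <= F p q) ->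
  \int[leb]_x \int[leb]_y F (a * x + b * y)%R (x ^+ 2 + y ^+ 2)%R =
  \int[leb]_x \int[leb]_y F (Num.sqrt (a ^+ 2 + b ^+ 2) * x)%R (x ^+ 2 + y ^+ 2)%R.
Proof.
move=> mF F0; set r := Num.sqrt _.
have r2 : (r ^+ 2 = a ^+ 2 + b ^+ 2)%R by rewrite sqr_sqrtr// addr_ge0 ?sqr_ge0.
pose G (e : R) (p : R * R) := F (e * p.1)%R (p.1 ^+ 2 + p.2 ^+ 2)%R.
have mG e : measurable_fun [set: R * R] (G e).
  apply: (measurableT_comp (f := fun p : R * R => F p.1 p.2)
    (g := fun p : R * R => (e * p.1, p.1 ^+ 2 + p.2 ^+ 2)%R) mF).
  apply/measurable_fun_pairP; split => /=.
    exact: measurable_funM.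
  by apply: measurable_funD; exact: measurable_funX.
(* The half-turn, which the three shears cannot produce: here [b = 0], and reflecting [x] alone is
   enough. *)
have [ra|ra] := eqVneq a (- r)%R.
  have b0 : b = 0%R by apply/eqP; rewrite -sqrf_eq0; apply/eqP; rewrite ra in r2; lra.
  rewrite b0 ra -(ge0_integral_opp (f := fun x => \int[leb]_y F (r * x)%R (x ^+ 2 + y ^+ 2)%R)).
  - apply: eq_integral => x _; apply: eq_integral => y _.
    by rewrite sqrrN mul0r addr0 mulrN mulNr.
  - by have := measurable_fun_fubini_tonelli_F (m2 := leb) (G r) (mG r); apply => p; exact: F0.
  - by move=> x; exact: integral_ge0.
(* [r = 0] forces [a = 0 = - r], which belongs to the case already treated. *)
have [r0|r0] := eqVneq r 0%R.
  have : (a ^+ 2 <= 0)%R by rewrite r0 in r2; have := sqr_ge0 b; lra.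
  rewrite le_eqVlt ltNge sqr_ge0/= orbF sqrf_eq0 => /eqP a0.
  by exfalso; move: ra; rewrite r0 a0 oppr0 eqxx.
have cs1 : ((a / r) ^+ 2 + (- (b / r)) ^+ 2 = 1)%R.
  by rewrite sqrrN !expr_div_n -mulrDl -r2 divff// sqrf_eq0.
have cN1 : (a / r != -1)%R.
  by apply: contra ra => /eqP h; apply/eqP; rewrite -[LHS](divfK r0) h mulN1r.
apply: etrans (ge0_integral_rotation (mG r) (fun p => F0 _ _) cs1 cN1).
apply: eq_integral => x _; apply: eq_integral => y _; congr (F _ _).
  by rewrite /=; field.
transitivity (((a / r) ^+ 2 + (- (b / r)) ^+ 2) * (x ^+ 2 + y ^+ 2))%R.
  by rewrite cs1 mul1r.
by rewrite /=; ring.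
Qed.

End plane.

(** * Lebesgue measure on column vectors *)

Section dot_product.
Context {R : realType}.

Lemma dotvC n (v w : 'cV[R]_n) : dotv v w = dotv w v.
Proof. by apply: eq_bigr => i _; rewrite mulrC. Qed.

Lemma dotvDr n (v w z : 'cV[R]_n) : dotv v (w + z) = dotv v w + dotv v z.
Proof. by rewrite -big_split; apply: eq_bigr => i _; rewrite mxE mulrDr. Qed.

Lemma dotvZr n (a : R) (v w : 'cV[R]_n) : dotv v (a *: w) = a * dotv v w.
Proof. by rewrite mulr_sumr; apply: eq_bigr => i _; rewrite mxE mulrCA. Qed.

Lemma dotvDl n (v w z : 'cV[R]_n) : dotv (v + w) z = dotv v z + dotv w z.
Proof. by rewrite dotvC dotvDr !(dotvC z). Qed.

Lemma dotvZl n (a : R) (v w : 'cV[R]_n) : dotv (a *: v) w = a * dotv v w.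
Proof. by rewrite dotvC dotvZr dotvC. Qed.

Lemma dotvN n (v w : 'cV[R]_n) : dotv v (- w) = - dotv v w.
Proof. by rewrite -scaleN1r dotvZr mulN1r. Qed.

Lemma dot0v n (v : 'cV[R]_n) : dotv 0 v = 0.
Proof. by rewrite -[0](scale0r 0) dotvZl mul0r. Qed.

Lemma dotv_ge0 n (v : 'cV[R]_n) : 0 <= dotv v v.
Proof. by apply: sumr_ge0 => i _; rewrite -expr2 sqr_ge0. Qed.

Lemma dotv_eq0 n (v : 'cV[R]_n) : (dotv v v == 0) = (v == 0).
Proof.
apply/idP/eqP => [|->]; last by rewrite dot0v.
rewrite psumr_eq0 => [/allP v0|i _]; last by rewrite -expr2 sqr_ge0.
apply/colP => i; rewrite mxE.
by have := v0 i (mem_index_enum _); rewrite /= -expr2 sqrf_eq0 => /eqP.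
Qed.

Lemma dotv_delta n (v : 'cV[R]_n) i : dotv v (delta_mx i ord0) = v i ord0.
Proof.
rewrite /dotv (bigD1 i)//= big1 => [|j /negbTE ji].
  by rewrite mxE !eqxx mulr1 addr0.
by rewrite mxE ji mulr0.
Qed.

Lemma enorm_ge0 n (v : 'cV[R]_n) : 0 <= enorm v.
Proof. exact: sqrtr_ge0. Qed.

Lemma sqr_enorm n (v : 'cV[R]_n) : enorm v ^+ 2 = dotv v v.
Proof. by rewrite sqr_sqrtr ?dotv_ge0. Qed.

Lemma enorm_eq0 n (v : 'cV[R]_n) : (enorm v == 0) = (v == 0).
Proof. by rewrite -sqrf_eq0 sqr_enorm dotv_eq0. Qed.

Lemma enormZ n (a : R) (v : 'cV[R]_n) : enorm (a *: v) = `|a| * enorm v.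
Proof. by rewrite /enorm dotvZl dotvZr mulrA sqrtrM ?sqr_ge0// sqrtr_sqr. Qed.

Lemma enormN n (v : 'cV[R]_n) : enorm (- v) = enorm v.
Proof. by rewrite -scaleN1r enormZ normrN1 mul1r. Qed.

Lemma cauchy_schwarz n (v w : 'cV[R]_n) : `|dotv v w| <= enorm v * enorm w.
Proof.
have [->|w0] := eqVneq w 0.
  by rewrite dotvC dot0v normr0 mulr_ge0 ?enorm_ge0.
have d0 : 0 < dotv w w by rewrite lt_neqAle dotv_ge0 eq_sym dotv_eq0 w0.
rewrite -ler_sqr ?nnegrE ?mulr_ge0 ?enorm_ge0//.
rewrite real_normK ?num_real// exprMn !sqr_enorm.
have := dotv_ge0 (dotv w w *: v - dotv v w *: w).
rewrite -scaleNr dotvDl !dotvDr !dotvZl !dotvZr (dotvC w v) => h.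
have : 0 <= dotv w w * (dotv v v * dotv w w - dotv v w ^+ 2).
  by move: h; congr (_ <= _); ring.
by rewrite pmulr_rge0// subr_ge0.
Qed.

Lemma measurable_dotv n (v : 'cV[R]_n) :
  measurable_fun [set: 'cV[R]_n] (dotv v).
Proof.
apply: measurable_sum => i; apply: measurable_funM => //.
exact: measurable_coord.
Qed.

Lemma measurable_dotvv n : measurable_fun [set: 'cV[R]_n] (fun w => dotv w w).
Proof.
by apply: measurable_sum => i; apply: measurable_funM; exact: measurable_coord.
Qed.

Lemma measurable_enorm n : measurable_fun [set: 'cV[R]_n] enorm.
Proof.
apply: (measurableT_comp (f := @Num.sqrt R)); last exact: measurable_dotvv.
by apply: continuous_measurable_fun => x; exact: sqrt_continuous.
Qed.

Definition tailv n (v : 'cV[R]_n.+1) : 'cV[R]_n := \col_i v (lift ord0 i) ord0.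

Lemma dotv_consv n (v : 'cV[R]_n.+1) (x : R) (u : 'cV[R]_n) :
  dotv v (consv (x, u)) = v ord0 ord0 * x + dotv (tailv v) u.
Proof.
rewrite /dotv big_ord_recl consv0; congr (_ + _).
by apply: eq_bigr => i _; rewrite consvS mxE.
Qed.

Lemma tailv_consv n (x : R) (u : 'cV[R]_n) : tailv (consv (x, u)) = u.
Proof. by apply/colP => i; rewrite mxE consvS. Qed.

End dot_product.

(** * Iterated integrals, scaling, reflection and isotropy in every dimension *)

Section space.
Context {R : realType}.
Notation leb := (@lebesgue_measure R).
Notation lebn n := (@lebesgue_cV R n).
Local Open Scope ereal_scope.

(** [lebesgue_cV n.+1] unfolds to the pushforward along [consv] of a product measure, so this is
    Tonelli. The inductions on the dimension below all pass through it. *)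
Lemma ge0_integral_cV_recl n (f : 'cV[R]_n.+1 -> \bar R) :
  measurable_fun setT f -> (forall w, 0 <= f w) ->
  \int[lebn n.+1]_w f w = \int[leb]_x \int[lebn n]_u f (consv (x, u)).
Proof.
move=> mf f0.
transitivity (\int[pushforward (leb \x lebn n) (@consv R n)]_w f w); first by [].
rewrite (ge0_integral_pushforward (@measurable_consv R n))//.
apply: (@fubini_tonelli1 _ _ _ _ _ leb (lebn n)) => [|p]; last exact: f0.
by apply: (measurableT_comp mf); exact: measurable_consv.
Qed.

Lemma measurable_consvr n (x : R) : measurable_fun [set: 'cV[R]_n] (fun u => consv (x, u)).
Proof.
apply: (measurableT_comp (f := @consv R n) (g := pair x)).
  exact: measurable_consv.
exact: measurable_pair1.
Qed.

Lemma measurable_scalev n (r : R) : measurable_fun [set: 'cV[R]_n] (fun w => r *: w).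
Proof.
apply: measurable_fun_cVP => i; under eq_fun do rewrite mxE.
by apply: measurable_funM => //; exact: measurable_coord.
Qed.

Lemma measurable_oppv n : measurable_fun [set: 'cV[R]_n] (fun w => - w)%R.
Proof.
apply: measurable_fun_cVP => i; under eq_fun do rewrite mxE.
by apply: measurable_funN; exact: measurable_coord.
Qed.

Lemma scale_consv n (r x : R) (u : 'cV[R]_n) : r *: consv (x, u) = consv (r * x, r *: u)%R.
Proof.
apply/colP => i; rewrite mxE; case: (unliftP ord0 i) => [j|] ->.
  by rewrite !consvS mxE.
by rewrite !consv0.
Qed.

Lemma opp_consv n (x : R) (u : 'cV[R]_n) : (- consv (x, u) = consv (- x, - u))%R.
Proof. by rewrite -[LHS]scaleN1r scale_consv mulN1r scaleN1r. Qed.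

Lemma ge0_integral_cV_scale n (r : R) (f : 'cV[R]_n -> \bar R) : (0 < r)%R ->
  measurable_fun setT f -> (forall w, 0 <= f w) ->
  \int[lebn n]_w f (r *: w) = (r ^- n)%:E * \int[lebn n]_w f w.
Proof.
move=> r0; elim: n f => [|n IH] f mf f0.
  rewrite expr0 invr1 mul1e; apply: eq_integral => w _; congr f.
  by apply/colP => -[].
have mfr : measurable_fun [set: 'cV[R]_n.+1] (fun w => f (r *: w)).
  exact: (measurableT_comp mf (@measurable_scalev n.+1 r)).
rewrite (ge0_integral_cV_recl mf f0) (ge0_integral_cV_recl mfr (fun w => f0 _)).
pose g x := \int[lebn n]_u f (consv (x, u)).
have mg : measurable_fun [set: R] g.
  apply: (measurable_fun_fubini_tonelli_F (f \o @consv R n)) => [|p]; last exact: f0.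
  by apply: (measurableT_comp mf); exact: measurable_consv.
have g0 x : 0 <= g x by exact: integral_ge0.
transitivity (\int[leb]_x ((r ^- n)%:E * g (r * x)%R)).
  apply: eq_integral => x _.
  rewrite -(IH _ (measurableT_comp mf (@measurable_consvr n (r * x))) (fun u => f0 _)).
  by apply: eq_integral => u _; rewrite scale_consv.
have mgr : measurable_fun [set: R] (fun x => g (r * x)%R).
  by apply: (measurableT_comp mg); exact: measurable_funM.
have rn0 : (0 <= r ^- n)%R by rewrite invr_ge0 exprn_ge0// ltW.
rewrite (ge0_integralZl_EFin leb measurableT (fun x _ => g0 _) mgr rn0).
have -> : \int[leb]_x g (r * x)%R = \int[leb]_x g (r * x + 0)%R.
  by apply: eq_integral => x _; rewrite addr0.
by rewrite (ge0_integral_affine 0 r0 mg g0) muleA -EFinM -invfM -exprSr.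
Qed.

Lemma ge0_integral_cV_opp n (f : 'cV[R]_n -> \bar R) :
  measurable_fun setT f -> (forall w, 0 <= f w) ->
  \int[lebn n]_w f (- w)%R = \int[lebn n]_w f w.
Proof.
elim: n f => [|n IH] f mf f0.
  by apply: eq_integral => w _; congr f; apply/colP => -[].
have mfN : measurable_fun [set: 'cV[R]_n.+1] (fun w => f (- w)%R).
  exact: (measurableT_comp mf (@measurable_oppv n.+1)).
rewrite (ge0_integral_cV_recl mf f0) (ge0_integral_cV_recl mfN (fun w => f0 _)).
pose g x := \int[lebn n]_u f (consv (x, u)).
have mg : measurable_fun [set: R] g.
  apply: (measurable_fun_fubini_tonelli_F (f \o @consv R n)) => [|p]; last exact: f0.
  by apply: (measurableT_comp mf); exact: measurable_consv.
rewrite -[RHS](ge0_integral_opp mg) => [|x]; last exact: integral_ge0.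
apply: eq_integral => x _.
apply/esym; apply: etrans
  (esym (IH _ (measurableT_comp mf (@measurable_consvr n (- x))) (fun u => f0 _))) _.
by apply/esym/eq_integral => u _; rewrite opp_consv.
Qed.

(** Induction on the dimension. At fixed first coordinate, the induction hypothesis replaces the
    product with the tail of [v] by [b = |tailv v|] times the next coordinate. Only two coordinates
    then enter linearly, with coefficients [a] and [b], and the planar case merges these into the
    length of [(a, b)], which is [|v|]. *)
Lemma ge0_integral_cV_iso n (F : R -> R -> \bar R) (v : 'cV[R]_n.+1) :
  measurable_fun [set: R * R] (fun p => F p.1 p.2) -> (forall p q, 0 <= F p q) ->
  \int[lebn n.+1]_w F (dotv v w) (dotv w w) =
  \int[lebn n.+1]_w F (enorm v * w ord0 ord0)%R (dotv w w).
Proof.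
have mP d (T : measurableType d) (a b : T -> R) (G : R -> R -> \bar R) :
    measurable_fun [set: R * R] (fun p => G p.1 p.2) ->
    measurable_fun setT a -> measurable_fun setT b ->
    measurable_fun setT (fun w => G (a w) (b w)).
  move=> mG ma mb.
  apply: (measurableT_comp (f := fun p : R * R => G p.1 p.2)
    (g := fun w => (a w, b w)) mG).
  exact/measurable_fun_pairP.
have mL m (v' : 'cV[R]_m.+1) (G : R -> R -> \bar R) :
    measurable_fun [set: R * R] (fun p => G p.1 p.2) ->
    measurable_fun setT (fun w : 'cV[R]_m.+1 => G (dotv v' w) (dotv w w)).
  by move=> mG; apply: mP => //; [exact: measurable_dotv|exact: measurable_dotvv].
have mR m (r : R) (G : R -> R -> \bar R) :
    measurable_fun [set: R * R] (fun p => G p.1 p.2) ->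
    measurable_fun setT (fun w : 'cV[R]_m.+1 => G (r * w ord0 ord0)%R (dotv w w)).
  move=> mG; apply: mP => //; last exact: measurable_dotvv.
  by apply: measurable_funM => //; exact: measurable_coord.
elim: n F v => [|n IH] F v mF F0.
  (* In dimension one only the sign of the coordinate of [v] matters, and a reflection of [w]
     changes it. *)
  have [v0|v0] := leP 0%R (v ord0 ord0).
    apply: eq_integral => w _; congr (F _ _).
    by rewrite /enorm /dotv !big_ord1 -expr2 sqrtr_sqr ger0_norm.
  rewrite -[RHS]ge0_integral_cV_opp//; last exact: mR.
  apply: eq_integral => w _; congr (F _ _).
    by rewrite /enorm /dotv !big_ord1 -expr2 sqrtr_sqr ltr0_norm// mxE mulrNN.
  by rewrite dotvN dotvC dotvN opprK.
set a := v ord0 ord0; set b := enorm (tailv v).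
(* All coordinates after the first two are integrated out; they enter only through their
   contribution to the squared norm. *)
pose H p q := \int[lebn n]_t F p (q + dotv t t)%R.
have mH : measurable_fun [set: R * R] (fun p => H p.1 p.2).
  apply: (measurable_fun_fubini_tonelli_F (m2 := lebn n)
    (fun z : (R * R) * 'cV[R]_n => F z.1.1 (z.1.2 + dotv z.2 z.2)%R)) => [|z].
    apply: (mP _ _ (fun z : (R * R) * 'cV[R]_n => z.1.1)
      (fun z => z.1.2 + dotv z.2 z.2)%R F) => //.
      exact: (measurableT_comp (f := fst) (g := fst)).
    apply: measurable_funD; first exact: (measurableT_comp (f := snd) (g := fst)).
    exact: (measurableT_comp (f := fun w : 'cV[R]_n => dotv w w) (g := snd)
      (@measurable_dotvv R n) measurable_snd).
  exact: F0.
have H0 p q : 0 <= H p q by exact: integral_ge0.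
have splitH (c d : R) :
    \int[leb]_x \int[lebn n.+1]_u
      F (c * x + d * u ord0 ord0)%R (x ^+ 2 + dotv u u)%R =
    \int[leb]_x \int[leb]_y H (c * x + d * y)%R (x ^+ 2 + y ^+ 2)%R.
  apply: eq_integral => x _; apply: etrans (ge0_integral_cV_recl _ (fun u => F0 _ _)) _.
    apply: mP => //.
      apply: measurable_funD => //; apply: measurable_funM => //.
      exact: measurable_coord.
    by apply: measurable_funD => //; exact: measurable_dotvv.
  apply: eq_integral => y _; apply: eq_integral => t _.
  by rewrite consv0 dotv_consv consv0 tailv_consv -expr2 addrA.
rewrite (ge0_integral_cV_recl (mL _ v _ mF) (fun w => F0 _ _)).
rewrite (ge0_integral_cV_recl (mR _ (enorm v) _ mF) (fun w => F0 _ _)).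
(* The induction hypothesis is applied to [F] with the contributions of the first coordinate [x]
   absorbed into both arguments. *)
transitivity (\int[leb]_x \int[lebn n.+1]_u
    F (a * x + b * u ord0 ord0)%R (x ^+ 2 + dotv u u)%R).
  apply: eq_integral => x _.
  rewrite -(IH (fun p q => F (a * x + p) (x ^+ 2 + q))%R)//.
    apply: eq_integral => u _.
    by rewrite !dotv_consv consv0 tailv_consv expr2.
  apply: (measurableT_comp (f := fun p : R * R => F p.1 p.2)
    (g := fun p : R * R => (a * x + p.1, x ^+ 2 + p.2)%R) mF).
  by apply/measurable_fun_pairP; split => /=; exact: measurable_funD.
rewrite splitH.
apply: etrans (ge0_integral_plane_iso a b mH H0) _.
rewrite -/(enorm v).
have -> : Num.sqrt (a ^+ 2 + b ^+ 2) = enorm v.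
  rewrite /b sqr_enorm; congr Num.sqrt.
  by rewrite /dotv [RHS]big_ord_recl -expr2; congr (_ + _)%R; apply: eq_bigr => i _; rewrite mxE.
transitivity (\int[leb]_x \int[lebn n.+1]_u
    F (enorm v * x + 0 * u ord0 ord0)%R (x ^+ 2 + dotv u u)%R).
  rewrite splitH; apply: eq_integral => x _; apply: eq_integral => y _.
  by rewrite mul0r addr0.
apply: eq_integral => x _; apply: eq_integral => u _.
by rewrite mul0r addr0 dotv_consv consv0 tailv_consv expr2.
Qed.

End space.

(** * Power weights *)

Section weight.
Context {R : realType} {n : nat}.
Implicit Types (w : 'cV[R]_n) (j : nat) (a : R).

(** Away from the origin this is [|w|^(2 j - a)]. The natural and the real exponent are kept apart
    so that a factor [|w|^2] only increments [j], and so that for [0 < j] the value at the origin is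
    0 whatever [a] is. *)
Definition weight j a w : R := dotv w w ^+ j / enorm w `^ a.

Lemma weight_ge0 j a w : 0 <= weight j a w.
Proof. by rewrite divr_ge0 ?powR_ge0// exprn_ge0// dotv_ge0. Qed.

Lemma weight0 j a : (0 < j)%N -> weight j a 0 = 0.
Proof. by move=> j0; rewrite /weight dot0v expr0n gtn_eqF// mul0r. Qed.

Lemma weightS j a w : weight j.+1 a w = dotv w w * weight j a w.
Proof. by rewrite /weight exprS mulrA. Qed.

Lemma weightS2 j a w : (0 < j)%N -> weight j.+1 (a + 2) w = weight j a w.
Proof.
have [->|w0] := eqVneq w 0; first by move=> j0; rewrite !weight0.
move=> _; have e0 : enorm w != 0 by rewrite enorm_eq0.
rewrite /weight powRD ?e0 ?implybT// powR_mulrn ?enorm_ge0// sqr_enorm.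
rewrite exprSr invfM mulrACA -[RHS]mulr1; congr (_ * _).
by rewrite divff// dotv_eq0.
Qed.

Lemma weightE j a w : w != 0 -> weight j a w = enorm w `^ (2 * j%:R - a).
Proof.
move=> w0; have e0 : enorm w != 0 by rewrite enorm_eq0.
rewrite powRB ?e0 ?implybT// -(natrM _ 2) powR_mulrn ?enorm_ge0//.
by rewrite exprM sqr_enorm.
Qed.

Lemma weightZ j a (r : R) w : 0 < r ->
  weight j a (r *: w) = r `^ (2 * j%:R - a) * weight j a w.
Proof.
move=> r0; have rn0 : r != 0 by rewrite gt_eqF.
rewrite powRB ?rn0 ?implybT// -(natrM _ 2) powR_mulrn ?ltW//.
rewrite /weight dotvZl dotvZr mulrA -expr2 exprMn -exprM enormZ gtr0_norm//.
by rewrite powRM ?enorm_ge0 ?(ltW r0)// invfM mulrACA.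
Qed.

Lemma measurable_weight j a : measurable_fun setT (weight j a).
Proof.
apply: measurable_funM; first exact: (measurable_funX j (@measurable_dotvv R n)).
apply: (measurableT_comp (f := fun x : R => (x `^ a)^-1) (g := enorm)).
  under eq_fun do rewrite -powRN.
  exact: measurable_powR.
exact: measurable_enorm.
Qed.

(** Closed inside and open outside, unlike [annulus], so that consecutive shells, or a ball and the
    shell around it, fit together without gap or overlap. *)
Definition shell (e d : R) : set 'cV[R]_n := [set w | e <= enorm w < d].

Let measurable_enorm_preimage (A : set R) : measurable A ->
  measurable [set w : 'cV[R]_n | A (enorm w)].
Proof.
by move=> mA; rewrite -[X in measurable X]setTI; exact: measurable_enorm.
Qed.

Lemma measurable_eball (d : R) : measurable (eball d : set 'cV[R]_n).
Proof.
rewrite (_ : eball d = [set w | `]-oo, d[%classic (enorm w)]).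
  exact: measurable_enorm_preimage.
by apply/seteqP; split => w; rewrite /= in_itv.
Qed.

Lemma measurable_shell (e d : R) : measurable (shell e d).
Proof.
rewrite (_ : shell e d = [set w | `[e, d[%classic (enorm w)]).
  exact: measurable_enorm_preimage.
by apply/seteqP; split => w; rewrite /= in_itv.
Qed.

Lemma measurable_annulus (e d : R) : measurable (annulus e d : set 'cV[R]_n).
Proof.
rewrite (_ : annulus e d = [set w | `]e, d[%classic (enorm w)]).
  exact: measurable_enorm_preimage.
by apply/seteqP; split => w; rewrite /= in_itv.
Qed.

Lemma coord_le_enorm w i : `|w i ord0| <= enorm w.
Proof.
rewrite -dotv_delta dotvC (le_trans (cauchy_schwarz _ _))//.
rewrite [X in X * _](_ : _ = 1) ?mul1r//.
by rewrite /enorm dotv_delta mxE !eqxx sqrtr1.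
Qed.

Lemma lebesgue_cV_eball_lty (d : R) : (lebesgue_cV n (eball d) < +oo)%E.
Proof.
have mB i : measurable (`[- d, d]%classic : set R) by [].
pose B := [set w : 'cV[R]_n | forall i, `[- d, d]%classic (w i ord0)].
have Bfin : (lebesgue_cV n B < +oo)%E.
  rewrite (lebesgue_cV_box (A := fun=> `[- d, d]%classic))//.
  under eq_bigr do rewrite lebesgue_measure_itv/=.
  rewrite ltey_eq prode_fin_num// => i _.
  by case: ifPn => _; rewrite // -EFinB.
apply: le_lt_trans Bfin; apply: le_measure; rewrite ?inE.
- exact: measurable_eball.
- rewrite (_ : B = \bigcap_(i in [set: 'I_n])
      ((fun v : 'cV[R]_n => v i ord0) @^-1` `[- d, d]%classic)); last first.
    by apply/seteqP; split=> v h i; [move=> _|]; exact: h.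
  apply: fin_bigcap_measurable => // i _.
  by rewrite -[X in measurable X]setTI; exact: measurable_coord.
- move=> w wd i; rewrite /= in_itv/= -ler_norml.
  by rewrite (le_trans (coord_le_enorm _ _))// ltW.
Qed.

Lemma integrable_weight_shell j a (e d : R) : 0 < e ->
  (lebesgue_cV n).-integrable (shell e d) (EFin \o weight j a).
Proof.
move=> e0; apply: measurable_bounded_integrable.
- exact: measurable_shell.
- apply: le_lt_trans (lebesgue_cV_eball_lty d).
  apply: le_measure; rewrite ?inE; [exact: measurable_shell|exact: measurable_eball|].
  by move=> w /= /andP[].
- by apply: measurable_funTS; exact: measurable_weight.
set s := 2 * j%:R - a.
(* A power is monotone whatever the sign of [s], so its values on the shell are bounded by one of
   the two endpoint values, and by their sum in any case. *)
exists (e `^ s + d `^ s); split; first by rewrite num_real.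
move=> M sM w /= /andP[ew wd]; apply: le_trans (ltW sM).
have w0 : w != 0 by rewrite -enorm_eq0 gt_eqF// (lt_le_trans e0).
have we0 := lt_le_trans e0 ew.
rewrite ger0_norm ?weight_ge0// weightE// -/s.
have [s0|s0] := leP 0 s.
  rewrite -[leLHS]add0r lerD ?powR_ge0// ge0_ler_powR// ?nnegrE ?enorm_ge0 ?ltW//.
  exact: lt_trans wd.
rewrite -[leLHS]addr0 lerD ?powR_ge0//.
rewrite -[s]opprK powRN [leRHS]powRN lef_pV2 ?posrE ?powR_gt0//.
by rewrite ge0_ler_powR// ?nnegrE ?oppr_ge0 ?ltW.
Qed.

End weight.

(** * Integrals of power weights over balls *)

Section radial.
Context {R : realType} {n : nat}.
Notation leb := (lebesgue_cV n : {measure set 'cV[R]_n -> \bar R}).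
Implicit Types (w : 'cV[R]_n) (j : nat) (a d r : R).

(** The degree of homogeneity, in the radius of the ball, of the integral of [weight j a]; its
    positivity gives convergence at the origin. *)
Let dim j a : R := n%:R + 2 * j%:R - a.

Lemma ge0_integral_weight_scale j a r (A B : set 'cV[R]_n) : 0 < r ->
  measurable A -> measurable B -> (forall w, (r *: w \in B) = (w \in A)) ->
  (\int[leb]_(w in B) (weight j a w)%:E =
  (r `^ dim j a)%:E * \int[leb]_(w in A) (weight j a w)%:E)%E.
Proof.
move=> r0 mA mB BA; rewrite [LHS]integral_mkcond [X in _ = (_ * X)%E]integral_mkcond.
pose f C := (fun w : 'cV[R]_n => (weight j a w)%:E) \_ C.
rewrite -/(f A) -/(f B).
have mf C : measurable C -> measurable_fun setT (f C).
  move=> mC; apply/(measurable_restrictT _ mC)/measurable_funTS.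
  by apply/measurable_EFinP; exact: measurable_weight.
have f0 C w : (0 <= f C w)%E.
  by rewrite /f patchE; case: ifPn => // _; rewrite lee_fin weight_ge0.
have p0 : 0 <= r `^ (2 * j%:R - a) by exact: powR_ge0.
have fr w : f B (r *: w) = ((r `^ (2 * j%:R - a))%:E * f A w)%E.
  rewrite /f /patch BA; case: ifPn => _; last by rewrite mule0.
  by rewrite weightZ// EFinM.
have h : ((r `^ (2 * j%:R - a))%:E * \int[leb]_w f A w = (r ^- n)%:E * \int[leb]_w f B w)%E.
  rewrite -(ge0_integral_cV_scale r0 (mf B mB) (f0 B)).
  rewrite -(ge0_integralZl_EFin leb measurableT (fun w _ => f0 A w) (mf A mA) p0).
  by apply: eq_integral => w _; rewrite fr.
have rn : 0 < r ^+ n by rewrite exprn_gt0.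
transitivity ((r ^+ n)%:E * ((r ^- n)%:E * \int[leb]_w f B w))%E.
  by rewrite muleA -EFinM divff ?gt_eqF// mul1e.
rewrite -h muleA -EFinM; congr (_%:E * _)%E.
rewrite -powR_mulrn ?ltW// -powRD ?(gt_eqF r0) ?implybT//.
by rewrite /dim addrA.
Qed.

Lemma weight_shellD j a e f d : e <= f <= d ->
  (\int[leb]_(w in shell e d) (weight j a w)%:E =
  \int[leb]_(w in shell e f) (weight j a w)%:E +
  \int[leb]_(w in shell f d) (weight j a w)%:E)%E.
Proof.
move=> /andP[ef fd].
have -> : shell e d = shell e f `|` shell f d :> set 'cV[R]_n.
  apply/seteqP; split => w /=.
    by move=> /andP[ew wd]; have [fw|wf] := leP f (enorm w);
      [right|left]; rewrite /shell/= ?fw ?ew.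
  move=> [|] /andP[].
    by move=> ew wf; rewrite /shell/= ew (lt_le_trans wf).
  by move=> fw wd; rewrite /shell/= wd (le_trans ef).
apply: ge0_integral_setU.
- exact: measurable_shell.
- exact: measurable_shell.
- apply: measurable_funTS; apply/measurable_EFinP; exact: measurable_weight.
- by move=> w _; rewrite lee_fin weight_ge0.
- apply/disj_setPS => w [/= /andP[_ wf] /andP[]].
  by rewrite leNgt wf.
Qed.

(** A scaling argument in place of polar coordinates. The integrals [k m] over the shells from
    [d / 2^m] to [d] satisfy [k (m + 1) = q k m + k 1], because the inner piece of the larger shell
    is half the previous shell. Since [q < 1], they stay below the fixed point [k 1 / (1 - q)], and
    monotone convergence passes to the ball. *)
Lemma integrable_weight j a d : (0 < j)%N -> 0 < d -> 0 < dim j a ->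
  leb.-integrable (eball d) (EFin \o weight j a).
Proof.
move=> j0 d0 s0.
have mW : measurable_fun setT (EFin \o (@weight R n j a)).
  by apply/measurable_EFinP; exact: measurable_weight.
have W0 w : (0 <= (EFin \o weight j a) w)%E by rewrite lee_fin weight_ge0.
pose e m := d / 2 ^+ m.
have e0 m : 0 < e m by rewrite divr_gt0// exprn_gt0.
have eS m : e m.+1 = 2^-1 * e m by rewrite /e exprS invfM mulrCA.
have e1 : e 1 = 2^-1 * d by rewrite eS /e expr0 divr1.
have ed m : e m <= d.
  by rewrite ler_pdivrMr ?exprn_gt0// ler_peMr ?(ltW d0)// exprn_ege1// ler1n.
have e1d m : e m.+1 <= e 1 
  by rewrite !eS ler_pM2l ?invr_gt0// (le_trans (ed m))// /e expr0 divr1.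
pose F m : set 'cV[R]_n := shell (e m) d.
pose q := 2^-1 `^ dim j a.
have q01 : 0 < q < 1.
  rewrite powR_gt0 ?invr_gt0//= (_ : 1 = 1 `^ dim j a); last by rewrite powR1.
  by rewrite gt0_ltr_powR ?nnegrE ?invr_ge0// invf_lt1// ltr1n.
have Ffin m : (\int[leb]_(w in F m) (weight j a w)%:E)%E \is a fin_num.
  by apply: integrable_fin_num; [exact: measurable_shell|exact: integrable_weight_shell].
pose k m := fine (\int[leb]_(w in F m) (weight j a w)%:E)%E.
have kE m : (\int[leb]_(w in F m) (weight j a w)%:E)%E = (k m)%:E by rewrite fineK.
have k0 m : 0 <= k m by apply: fine_ge0; apply: integral_ge0 => w _; exact: W0.
have kS m : k m.+1 = q * k m + k 1.
  apply: EFin_inj; rewrite EFinD EFinM -!kE /F.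
  rewrite (@weight_shellD _ _ _ (e 1)) ?e1d ?ed//; congr (_ + _)%E.
  apply: ge0_integral_weight_scale; rewrite ?invr_gt0//; try exact: measurable_shell.
  move=> w; apply/idP/idP; rewrite !inE /shell/= enormZ ger0_norm ?invr_ge0//;
    by rewrite e1 eS ler_pM2l ?ltr_pM2l ?invr_gt0.
have kle m : k m <= k 1 / (1 - q).
  have q1 : 0 < 1 - q by rewrite subr_gt0; case/andP: q01.
  elim: m => [|m IH].
    have F0 : F 0%N = set0.
      rewrite /F /e expr0 divr1; apply/seteqP; split => w //= /andP[dw].
      by rewrite ltNge dw.
    by rewrite [leLHS]/k F0 integral_set0 divr_ge0 ?k0 ?(ltW q1).
  have -> : k 1 / (1 - q) = q * (k 1 / (1 - q)) + k 1 by field; rewrite gt_eqF.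
  by rewrite kS lerD2r ler_pM2l//; case/andP: q01.
apply/integrableP; split; first exact: measurable_funTS.
under eq_integral do rewrite gee0_abs//.
(* The shells miss exactly the origin, where the weight is 0 because [0 < j]. *)
have -> : (\int[leb]_(w in eball d) (EFin \o weight j a) w =
           \int[leb]_(w in \bigcup_m F m) (EFin \o weight j a) w)%E.
  rewrite integral_mkcond [RHS]integral_mkcond; apply: eq_integral => w _.
  rewrite !patchE; have [->|w0] := eqVneq w 0.
    by rewrite /= weight0// !if_same.
  congr (if _ then _ else _); apply/idP/idP; rewrite !inE.
    move=> wd; have ew : 0 < enorm w by rewrite lt_neqAle enorm_ge0 eq_sym enorm_eq0 w0.
    exists (Num.bound (d / enorm w)) => //; rewrite /F /shell/= wd andbT.
    rewrite ler_pdivrMr ?exprn_gt0// mulrC -ler_pdivrMr//.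
    apply: (le_trans (ltW (archi_boundP (divr_ge0 (ltW d0) (ltW ew))))).
    by rewrite -natrX ler_nat ltnW// ltn_expl.
  by move=> [m _ /andP[]].
apply: (@le_lt_trans _ _ (k 1 / (1 - q))%:E); last by rewrite ltry.
have ndF : {homo F : n m / (n <= m)%N >-> (n <= m)%O}.
  move=> m1 m2 m12; apply/subsetPset => w /= /andP[mw wd].
  rewrite /F/= /shell/= wd andbT (le_trans _ mw)//.
  by rewrite ler_pM2l// lef_pV2 ?posrE ?exprn_gt0// ler_eXn2l// ltr1n.
have := @ge0_nondecreasing_set_cvg_integral _ _ _ F (EFin \o weight j a) leb ndF
  (fun m => measurable_shell _ _) (fun m => measurable_funTS mW) (fun m w _ => W0 w).
move=> /(cvg_lim _) <-//; apply: lime_le.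
  by apply: ereal_nondecreasing_is_cvgn; apply: ge0_nondecreasing_set_nondecreasing_integral => //;
    [move=> i; exact: measurable_shell|move=> i; exact: measurable_funTS].
by apply: nearW => m; rewrite kE lee_fin.
Qed.

Lemma integrable_weight_sub j a d (A : set 'cV[R]_n) : (0 < j)%N -> 0 < d ->
  0 < dim j a -> measurable A -> A `<=` eball d ->
  leb.-integrable A (EFin \o weight j a).
Proof.
move=> j0 d0 s0 mA Ad.
by apply: integrableS (integrable_weight j0 d0 s0) => //; exact: measurable_eball.
Qed.

Lemma weight_int_shell j a d r : (0 < j)%N -> 0 < d -> 0 < dim j a -> 0 < r < 1 ->
  \int[leb]_(w in shell (r * d) d) weight j a w =
  (1 - r `^ dim j a) * \int[leb]_(w in eball d) weight j a w.
Proof.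
move=> j0 d0 s0 /andP[r0 r1].
have rd : r * d < d by rewrite gtr_pMl.
have rdd : (eball (r * d) : set 'cV[R]_n) `<=` eball d.
  by move=> w /= /lt_trans; apply.
have Ed : eball d = eball (r * d) `|` shell (r * d) d :> set 'cV[R]_n.
  apply/seteqP; split => w /=.
    move=> wd; have [fw|wf] := leP (r * d) (enorm w); [right|left] => //.
    by rewrite /shell/= fw.
  by move=> [/rdd//|/andP[]].
have E1 : \int[leb]_(w in eball d) weight j a w =
    \int[leb]_(w in eball (r * d)) weight j a w +
    \int[leb]_(w in shell (r * d) d) weight j a w.
  rewrite [in LHS]Ed Rintegral_setU//.
  - exact: measurable_eball.
  - exact: measurable_shell.
  - by rewrite -Ed; exact: integrable_weight.
  - by apply/disj_setPS => w [/= wr /andP[]]; rewrite leNgt wr.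
have E2 : \int[leb]_(w in eball (r * d)) weight j a w =
    r `^ dim j a * \int[leb]_(w in eball d) weight j a w.
  rewrite /Rintegral (@ge0_integral_weight_scale j a r (eball d))//.
  - rewrite fineM//; apply: integrable_fin_num; first exact: measurable_eball.
    exact: integrable_weight.
  - exact: measurable_eball.
  - exact: measurable_eball.
  - move=> w; apply/idP/idP; rewrite !inE /eball/= enormZ gtr0_norm//;
      by rewrite ltr_pM2l.
by rewrite mulrBl mul1r -E2 E1; ring.
Qed.

Let le_of_forall_scaled (X Y Z : R) : 0 <= Z ->
  (forall t, 0 < t -> X <= Y + t * Z) -> X <= Y.
Proof.
move=> Z0 XY; apply/ler_addgt0Pr => e e0.
have Z1 : 0 < Z + 1 by rewrite ltr_wpDl.
apply: le_trans (XY (e / (Z + 1)) (divr_gt0 e0 Z1)) _.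
rewrite lerD2l -mulrA ler_piMr ?(ltW e0)// mulrC ler_pdivrMr// mul1r.
by rewrite lerDl.
Qed.

(* Both sides scale with a power of the radius, so on the shell
   [r d <= |w| < d], where [|w|^2] is pinched between [(r d)^2] and [d^2], they
   can be compared; the identity results for [r] tending to 1. *)
Lemma weight_int_rec j a d : (0 < j)%N -> 0 < d -> 0 < dim j a ->
  (dim j a + 2) * \int[leb]_(w in eball d) weight j.+1 a w =
  dim j a * (d ^+ 2 * \int[leb]_(w in eball d) weight j a w).
Proof.
move=> j0 d0 s0.
have dimS : dim j.+1 a = dim j a + 2 by rewrite /dim -natr1; ring.
have sS0 : 0 < dim j.+1 a by rewrite dimS addr_gt0.
set A := d ^+ 2 * _; set B := \int[leb]_(w in eball d) weight j.+1 a w.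
set s := dim j a in s0 dimS *.
have A0 : 0 <= A.
  by rewrite mulr_ge0 ?sqr_ge0//; apply: Rintegral_ge0 => w _; exact: weight_ge0.
have B0 : 0 <= B by apply: Rintegral_ge0 => w _; exact: weight_ge0.
(* Writing the ratio of radii as [expR (- t)] turns its powers into exponentials, so that the limit
   needs only [x / (1 + x) <= 1 - expR (- x) <= x]. *)
have pinch t : 0 < t ->
    expR (- t) ^+ 2 * ((1 - expR (- (s * t))) * A) <=
      (1 - expR (- ((s + 2) * t))) * B /\
    (1 - expR (- ((s + 2) * t))) * B <= (1 - expR (- (s * t))) * A.
  move=> t0; set r := expR (- t).
  have r01 : 0 < r < 1 by rewrite expR_gt0 -expR0 ltr_expR oppr_lt0.
  have rE x : r `^ x = expR (- (x * t)).
    by rewrite /powR gt_eqF ?expR_gt0// expRK mulrN.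
  have iW k : (0 < k)%N -> 0 < dim k a -> leb.-integrable (shell (r * d) d) (EFin \o weight k a).
    move=> k0 dk; apply: (integrable_weight_sub k0 d0 dk); first exact: measurable_shell.
    by move=> w /andP[].
  have iZ k c : (0 < k)%N -> 0 < dim k a ->
      leb.-integrable (shell (r * d) d) (EFin \o (fun w => c * weight k a w)).
    move=> k0 dk; have := integrableZl (measurable_shell (r * d) d) c (iW k k0 dk).
    by apply: eq_integrable => [|w _]; [exact: measurable_shell|rewrite /= EFinM].
  have bnd c : \int[leb]_(w in shell (r * d) d) (c * weight j a w) =
      c * ((1 - expR (- (s * t))) * \int[leb]_(w in eball d) weight j a w).
    rewrite RintegralZl ?(weight_int_shell j0 d0 s0 r01) ?rE//; first exact: measurable_shell.
    exact: iW.
  have := weight_int_shell (ltn0Sn j) d0 sS0 r01.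
  rewrite dimS rE -/B => <-.
  have rd0 : 0 < r * d by rewrite mulr_gt0//; case/andP: r01.
  have mid w : shell (r * d) d w ->
      (r * d) ^+ 2 * weight j a w <= weight j.+1 a w <= d ^+ 2 * weight j a w.
    move=> /andP[w1 w2]; rewrite weightS -sqr_enorm.
    by rewrite !ler_wpM2r ?weight_ge0// ler_sqr ?nnegrE ?enorm_ge0 ?(ltW rd0) ?(ltW d0) ?(ltW w2).
  split.
    rewrite [leLHS](_ : _ = \int[leb]_(w in shell (r * d) d) ((r * d) ^+ 2 * weight j a w)).
      apply: le_Rintegral; [exact: measurable_shell|exact: iZ j _ j0 s0|exact: iW|].
      by move=> w /mid/andP[].
    by rewrite bnd /A; ring.
  rewrite [leRHS](_ : _ = \int[leb]_(w in shell (r * d) d) (d ^+ 2 * weight j a w)).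
    apply: le_Rintegral; [exact: measurable_shell|exact: iW|exact: iZ j _ j0 s0|].
    by move=> w /mid/andP[].
  by rewrite bnd /A; ring.
have expU x : 0 < x -> 1 - expR (- x) <= x.
  by move=> x0; have := expR_ge1Dx (- x); lra.
have expL x : 0 < x -> x <= (1 + x) * (1 - expR (- x)).
  move=> x0; have e0 := expR_gt0 (- x); have e1 := expR_ge1Dx x.
  have ex : expR x * expR (- x) = 1 by rewrite -expRD addrN expR0.
  have : (1 + x) * expR (- x) <= 1 by rewrite -[leRHS]ex ler_pM2r.
  lra.
have s20 : 0 < s + 2 by rewrite addr_gt0.
(* Divided by [t], each half of the pinching is one inequality of the claim up to an error linear in
   [t]. The constants supplied below are the coefficients of these errors. *)
apply/eqP; rewrite eq_le; apply/andP; split.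
  apply: (@le_of_forall_scaled _ _ ((s + 2) * (s * A))) => [|t t0].
    by apply: mulr_ge0; [exact: ltW|apply: mulr_ge0; [exact: ltW|]].
  have [_ h] := pinch t t0.
  have st : 0 < (s + 2) * t by rewrite mulr_gt0.
  have h1 : (s + 2) * t * B <= (1 + (s + 2) * t) * ((s * t) * A).
    apply: (@le_trans _ _ ((1 + (s + 2) * t) * (1 - expR (- ((s + 2) * t))) * B)).
      by apply: ler_wpM2r => //; exact: expL.
    rewrite -[leLHS]mulrA.
    apply: ler_wpM2l; first by rewrite addr_ge0// ltW.
    by apply: (le_trans h); apply: ler_wpM2r => //; apply: expU; exact: mulr_gt0.
  by rewrite -(ler_pM2l t0); move: h1; congr (_ <= _); ring.
apply: (@le_of_forall_scaled _ _ (s * ((s + 2) * B) + 2 * (s * A))) => [|t t0].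
  have sB : 0 <= s * ((s + 2) * B).
    by apply: mulr_ge0; [exact: ltW|apply: mulr_ge0; [exact: ltW|]].
  by rewrite addr_ge0// mulr_ge0// mulr_ge0// ltW.
have [h _] := pinch t t0.
have st : 0 < s * t by rewrite mulr_gt0.
have st2 : 0 < (s + 2) * t by rewrite mulr_gt0.
have h1 : expR (- t) ^+ 2 * (s * t * A) <= (1 + s * t) * (((s + 2) * t) * B).
  have h1' : expR (- t) ^+ 2 * (s * t * A) <=
      (1 + s * t) * (expR (- t) ^+ 2 * ((1 - expR (- (s * t))) * A)).
    rewrite [leRHS]mulrCA; apply: ler_wpM2l; first exact: sqr_ge0.
    by rewrite [leRHS]mulrA; apply: ler_wpM2r => //; exact: expL.
  apply: (le_trans h1'); apply: ler_wpM2l; first by rewrite addr_ge0// ltW.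
  by apply: (le_trans h); apply: ler_wpM2r => //; exact: expU.
have e2 : 1 - 2 * t <= expR (- t) ^+ 2.
  by rewrite -expRM_natl; have := expR_ge1Dx (2 * - t); lra.
have h2 : (1 - 2 * t) * (s * t * A) <= (1 + s * t) * (((s + 2) * t) * B).
  by apply: le_trans h1; apply: ler_wpM2r => //; rewrite mulr_ge0// ltW.
rewrite -(ler_pM2l t0) -subr_ge0.
by move: h2; rewrite -subr_ge0; congr (_ <= _); ring.
Qed.

(** A zero integral would make the weight vanish almost everywhere on the ball, but it is positive
    on a small cube of positive measure. *)
Lemma weight_int_gt0 j a d : (0 < n)%N -> (0 < j)%N -> 0 < d -> 0 < dim j a ->
  0 < \int[leb]_(w in eball d) weight j a w.
Proof.
move=> n0 j0 d0 s0; rewrite lt_neqAle; apply/andP; split; last first.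
  by apply: Rintegral_ge0 => w _; exact: weight_ge0.
apply/negP => /eqP I0.
have iW := integrable_weight j0 d0 s0.
have mW : measurable_fun (eball d) (EFin \o (@weight R n j a)).
  by apply: measurable_funTS; apply/measurable_EFinP; exact: measurable_weight.
have : (\int[leb]_(w in eball d) `|(EFin \o weight j a) w| = 0)%E.
  under eq_integral do rewrite gee0_abs ?lee_fin ?weight_ge0//.
  rewrite -(fineK (integrable_fin_num (measurable_eball d) iW)).
  by congr EFin; rewrite [RHS]I0.
move/(ae_eq_integral_abs leb (measurable_eball d) mW) => [N [mN N0 WN]].
(* With this side the cube lies in the ball, since [n < (n + 1)^2]; being open at 0, it avoids the
   origin. *)
pose t := d / n.+1%:R.
have t0 : 0 < t by rewrite divr_gt0.
pose Q := [set w : 'cV[R]_n | forall i, `]0, t]%classic (w i ord0)].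
have QN : Q `<=` N.
  move=> w Qw; apply: WN => /= Ww.
  have w0 : w != 0.
    apply/eqP => w0; have := Qw (Ordinal n0).
    by rewrite w0 /= in_itv/= mxE ltxx.
  have wd : eball d w.
    rewrite /eball/= -ltr_sqr ?nnegrE ?enorm_ge0 ?ltW// sqr_enorm.
    apply: (@le_lt_trans _ _ (n%:R * t ^+ 2)).
      rewrite mulr_natl -[X in _ *+ X]card_ord -sumr_const ler_sum// => i _.
      have := Qw i; rewrite /= in_itv/= => /andP[wi0 wit].
      by rewrite -expr2 ler_sqr ?nnegrE ?(ltW wi0) ?(ltW t0).
    rewrite /t expr_div_n mulrCA gtr_pMr ?exprn_gt0//.
    rewrite ltr_pdivrMr ?exprn_gt0// mul1r -natrX ltr_nat.
    by rewrite expnS expn1 (@leq_trans n.+1)// leq_pmulr.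
  have := Ww wd; rewrite /= => -[] /eqP; apply/negP.
  by rewrite weightE// gt_eqF// powR_gt0// lt_neqAle enorm_ge0 eq_sym enorm_eq0 w0.
have Q0 : (0 < leb Q)%E.
  have -> : leb Q = (\prod_(i < n) lebesgue_measure (`]0%R, t]%classic : set R))%E.
    exact: (lebesgue_cV_box (A := fun=> `]0, t]%classic)).
  under eq_bigr do rewrite lebesgue_measure_itv/= lte_fin t0 oppr0 adde0.
  by elim/big_ind : _ => [|x y|i _]; [exact: lte01|exact: mule_gt0|rewrite lte_fin].
move: Q0; rewrite ltNge => /negP; apply; rewrite -N0.
apply: le_measure; rewrite ?inE//.
rewrite (_ : Q = \bigcap_(i in [set: 'I_n])
    ((fun v : 'cV[R]_n => v i ord0) @^-1` `]0, t]%classic)); last first.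
  by apply/seteqP; split=> v h i; [move=> _|]; exact: h.
apply: fin_bigcap_measurable => // i _.
by rewrite -[X in measurable X]setTI; exact: measurable_coord.
Qed.

End radial.

(** * Moments *)

Lemma poly_eq_horner (R : numFieldType) (p q : {poly R}) :
  (forall t, p.[t] = q.[t]) -> p = q.
Proof.
move=> pq; apply/eqP; rewrite -subr_eq0; apply/negPn/negP => pq0.
pose s : seq R := [seq k%:R | k <- iota 0 (size (p - q))].
have us : uniq s by rewrite map_inj_uniq ?iota_uniq//; exact: mulrIn (oner_neq0 R).
have rs : all (root (p - q)) s.
  by apply/allP => t _; rewrite /root hornerD hornerN pq subrr.
by have := max_poly_roots pq0 rs us; rewrite size_map size_iota ltnn.
Qed.

Lemma coef1_deriv (R : comNzRingType) (p : {poly R}) : p`_1 = (deriv p).[0].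
Proof. by rewrite horner_coef0 coef_deriv mulr1n. Qed.

Section integral_of_powers.
Context d (T : measurableType d) (R : realType) (mu : {measure set T -> \bar R}).
Variables (D : set T) (mD : measurable D).
Implicit Types f A B C : T -> R.

Lemma integrable_scale f c : mu.-integrable D (EFin \o f) ->
  mu.-integrable D (EFin \o (fun x => c * f x)).
Proof.
move=> fi; have := integrableZl mD c fi.
by apply: eq_integrable => // x _; rewrite /= EFinM.
Qed.

Lemma integrable_rsum I (s : seq I) (F : I -> T -> R) :
  (forall i, mu.-integrable D (EFin \o F i)) ->
  mu.-integrable D (EFin \o (fun x => \sum_(i <- s) F i x)).
Proof.
move=> Fi; have := @integrable_sum _ _ _ mu D mD _ s xpredT _ (fun i _ => Fi i).
by apply: eq_integrable => // x _; rewrite /= sumEFin.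
Qed.

Lemma Rintegral_sum I (s : seq I) (F : I -> T -> R) :
  (forall i, mu.-integrable D (EFin \o F i)) ->
  \int[mu]_(x in D) (\sum_(i <- s) F i x) = \sum_(i <- s) \int[mu]_(x in D) F i x.
Proof.
move=> Fi; elim: s => [|i s IH].
  under eq_Rintegral do rewrite big_nil.
  by rewrite big_nil /Rintegral integral0.
under eq_Rintegral do rewrite big_cons.
by rewrite big_cons RintegralD// ?IH//; exact: integrable_rsum.
Qed.

(** By the binomial theorem the integral is itself a polynomial in [t] with mixed integrals as
    coefficients. Two polynomials with equal values have equal coefficients, which takes the place
    of differentiating under the integral sign. *)
Lemma Rintegral_pow_coef1 N A B C (P : {poly R}) :
  (forall q, (q <= N.+1)%N ->
    mu.-integrable D (EFin \o (fun x => A x ^+ (N.+1 - q) * B x ^+ q * C x))) ->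
  (forall t, \int[mu]_(x in D) ((A x + t * B x) ^+ N.+1 * C x) = P.[t]) ->
  P`_1 = N.+1%:R * \int[mu]_(x in D) (A x ^+ N * B x * C x).
Proof.
move=> Iq PE; pose I q := \int[mu]_(x in D) (A x ^+ (N.+1 - q) * B x ^+ q * C x).
suff -> : P = \poly_(q < N.+2) (I q *+ 'C(N.+1, q)).
  rewrite coef_poly/= bin1 -[LHS]mulr_natl; congr (_ * _).
  by apply: eq_Rintegral => x _; rewrite subn1 expr1.
apply: poly_eq_horner => t; rewrite -PE horner_poly.
transitivity (\int[mu]_(x in D)
    (\sum_(q < N.+2) 'C(N.+1, q)%:R * t ^+ q * (A x ^+ (N.+1 - q) * B x ^+ q * C x))).
  apply: eq_Rintegral => x _; rewrite exprDn mulr_suml; apply: eq_bigr => q _.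
  by rewrite exprMn -mulr_natl; ring.
rewrite Rintegral_sum => [|q]; last first.
  by apply: integrable_scale; apply: Iq; rewrite -ltnS.
apply: eq_bigr => q _; rewrite RintegralZl//; last by apply: Iq; rewrite -ltnS.
by rewrite -/(I q) -mulr_natl; ring.
Qed.

End integral_of_powers.

Section moments.
Context {R : realType} {n : nat}.
Notation N := n.+1.
Notation leb := (lebesgue_cV N : {measure set 'cV[R]_N -> \bar R}).
Implicit Types (u v w y z : 'cV[R]_N) (i j : nat) (a d : R).

Lemma integrable_le_weight j a d C (f : 'cV[R]_N -> R) : (0 < j)%N -> 0 < d ->
  0 < N%:R + 2 * j%:R - a -> measurable_fun setT f ->
  (forall w, eball d w -> `|f w| <= C * weight j a w) ->
  leb.-integrable (eball d) (EFin \o f).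
Proof.
move=> j0 d0 s0 mf fW.
have iW := integrable_scale (measurable_eball d) C (integrable_weight j0 d0 s0).
apply: le_integrable iW; first exact: measurable_eball.
  by apply: measurable_funTS; apply/measurable_EFinP.
move=> w wd; rewrite /= lee_fin (le_trans (fW w wd))//; exact: ler_norm.
Qed.

(** Cauchy-Schwarz on each factor. Three directions suffice: the frequency, the amplitude of the
    mode and the coordinate in which the result is read. The even total degree turns the powers of
    [|w|] into an increment of the weight index. *)
Lemma normr_pow3_weight m i a (p q r : nat) u v y w : (p + q + r = m.*2)%N ->
  `|dotv u w ^+ p * dotv v w ^+ q * (dotv y w ^+ r * weight i a w)| <=
  enorm u ^+ p * enorm v ^+ q * enorm y ^+ r * weight (i + m) a w.
Proof.
move=> pqr; rewrite 3!normrM (ger0_norm (weight_ge0 _ _ _)) !normrX.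
have -> : weight (i + m) a w =
    enorm w ^+ p * enorm w ^+ q * (enorm w ^+ r * weight i a w).
  rewrite mulrA -!exprD pqr -mul2n exprM sqr_enorm /weight exprD; ring.
rewrite mulrA (_ : _ * (_ * _) = (enorm u ^+ p * enorm w ^+ p) *
  (enorm v ^+ q * enorm w ^+ q) * (enorm y ^+ r * enorm w ^+ r) * weight i a w); last by ring.
have cs x k : `|dotv x w| ^+ k <= enorm x ^+ k * enorm w ^+ k.
  by rewrite -exprMn lerXn2r ?nnegrE ?mulr_ge0 ?enorm_ge0 ?cauchy_schwarz.
apply: ler_wpM2r; first exact: weight_ge0.
by rewrite !ler_pM ?mulr_ge0 ?exprn_ge0 ?cs.
Qed.

Lemma measurable_pow3_weight i a (p q r : nat) u v y : measurable_fun setT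
  (fun w => dotv u w ^+ p * dotv v w ^+ q * (dotv y w ^+ r * weight i a w)).
Proof.
have mX x k : measurable_fun setT (fun w => dotv x w ^+ k).
  by apply: measurable_funX; exact: measurable_dotv.
apply: measurable_funM; first exact: measurable_funM.
by apply: measurable_funM => //; exact: measurable_weight.
Qed.

Lemma integrable_pow3_weight m i a d (p q r : nat) u v y : (0 < i + m)%N -> 0 < d ->
  0 < N%:R + 2 * (i + m)%:R - a -> (p + q + r = m.*2)%N ->
  leb.-integrable (eball d) (EFin \o
    (fun w => dotv u w ^+ p * dotv v w ^+ q * (dotv y w ^+ r * weight i a w))).
Proof.
move=> im d0 s0 pqr.
apply: (integrable_le_weight im d0 s0 (measurable_pow3_weight i a p q r u v y)) => w _.
exact: normr_pow3_weight.
Qed.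

Definition moment d a k i :=
  \int[leb]_(w in eball d) (w ord0 ord0 ^+ k.*2 * weight i a w).

(** Isotropy applied to a function of [dotv v w] and [|w|^2] that contains the cut-off to the ball;
    the even exponent provides the nonnegativity. *)
Lemma moment_dotv d a k i v : (0 < i + k)%N -> 0 < d ->
  0 < N%:R + 2 * (i + k)%:R - a ->
  \int[leb]_(w in eball d) (dotv v w ^+ k.*2 * weight i a w) =
  dotv v v ^+ k * moment d a k i.
Proof.
move=> ik d0 s0.
pose S := [set p : R * R | Num.sqrt p.2 < d].
(* The absolute value keeps [G] nonnegative on the whole plane; it has no effect at
   [p.2 = dotv w w]. *)
pose G (p : R * R) := (p.1 ^+ k.*2 * (`|p.2| ^+ i / Num.sqrt p.2 `^ a))%:E.
pose F p q := (G \_ S) (p, q).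
have msqrt : measurable_fun [set: R] Num.sqrt.
  by apply: continuous_measurable_fun => x; exact: sqrt_continuous.
have mS : measurable S.
  rewrite (_ : S = (Num.sqrt \o snd) @^-1` `]-oo, d[%classic); last first.
    by apply/seteqP; split => p; rewrite /= in_itv.
  rewrite -[X in measurable X]setTI.
  by apply: (measurableT_comp msqrt measurable_snd).
have mG : measurable_fun [set: R * R] G.
  apply/measurable_EFinP; apply: measurable_funM.
    by apply: measurable_funX; exact: measurable_fst.
  apply: measurable_funM.
    apply: measurable_funX.
    by apply: (measurableT_comp (f := fun x : R => `|x|)) => //; exact: measurable_snd.
  under eq_fun do rewrite -powRN.
  apply: (measurableT_comp (f := fun x : R => Num.sqrt x `^ (- a))) => //.
  by apply: (measurableT_comp (f := fun x : R => x `^ (- a))) => //; exact: measurable_powR.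
have mF : measurable_fun [set: R * R] (fun p => F p.1 p.2).
  rewrite (_ : (fun p => _) = G \_ S); last by apply/funext => -[].
  by apply/(measurable_restrictT _ mS)/measurable_funTS.
have F0 p q : (0 <= F p q)%E.
  rewrite /F patchE; case: ifPn => // _; rewrite lee_fin.
  apply: mulr_ge0; first by rewrite exprn_even_ge0 ?odd_double.
  by rewrite divr_ge0 ?exprn_ge0 ?powR_ge0.
have FE p w : F p (dotv w w) =
    if w \in eball d then (p ^+ k.*2 * weight i a w)%:E else 0%E.
  rewrite /F patchE (_ : ((p, dotv w w) \in S) = (w \in eball d)).
    by case: ifPn => // _; rewrite /G /= ger0_norm ?dotv_ge0.
  by apply/idP/idP; rewrite !inE.
have I0 : leb.-integrable (eball d)
    (EFin \o (fun w => w ord0 ord0 ^+ k.*2 * weight i a w)).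
  have := @integrable_pow3_weight k i a d k.*2 0 0 (delta_mx ord0 ord0) 0 0 ik d0 s0.
  rewrite !addn0 => /(_ erefl).
  apply: eq_integrable => [|w _]; first exact: measurable_eball.
  by rewrite /= !expr0 mulr1 mul1r dotvC dotv_delta.
rewrite /moment -RintegralZl//; last exact: measurable_eball.
rewrite /Rintegral; congr fine.
transitivity (\int[leb]_w F (dotv v w) (dotv w w))%E.
  by rewrite integral_mkcond; apply: eq_integral => w _; rewrite FE patchE.
rewrite [LHS]ge0_integral_cV_iso// [RHS]integral_mkcond.
apply: eq_integral => w _; rewrite FE patchE; case: ifPn => // _.
by rewrite exprMn -mul2n exprM sqr_enorm mulrA.
Qed.

Lemma moment_dotv1 d a k i v y : 0 < d -> 
  0 < N%:R + 2 * (i + k.+1)%:R - a ->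
  \int[leb]_(w in eball d) (dotv v w ^+ k.*2.+1 * dotv y w * weight i a w) =
  dotv v v ^+ k * dotv v y * moment d a k.+1 i.
Proof.
move=> d0 s0.
have ik : (0 < i + k.+1)%N by rewrite addnS.
(* [Q] is [|v + t y|^2] as a polynomial in [t]. The first-order coefficient of its power [k + 1]
   carries the factor [2 k + 2], which cancels against the binomial one. *)
pose Q : {poly R} := (dotv v v)%:P + 'X * ((2 * dotv v y)%:P + 'X * (dotv y y)%:P).
pose P := Q ^+ k.+1 * (moment d a k.+1 i)%:P.
have := @Rintegral_pow_coef1 _ _ _ leb _ (measurable_eball d) k.*2.+1
  (dotv v) (dotv y) (weight i a) P.
have -> : P`_1 = k.*2.+2%:R * (dotv v v ^+ k * dotv v y * moment d a k.+1 i).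
  rewrite coef1_deriv /P derivM derivC mulr0 addr0 deriv_exp.
  rewrite /Q !(poly.derivE, hornerE, hornerMn) /=.
  by rewrite -mulr_natl -[k.*2.+2]/(k.+1.*2) -mul2n natrM; ring.
move=> h; apply/esym; apply: (mulfI (_ : k.*2.+2%:R != 0)); first by rewrite pnatr_eq0.
apply: h.
  move=> q qk; have := @integrable_pow3_weight k.+1 i a d (k.*2.+2 - q) q 0 v y 0 ik d0 s0.
  rewrite addn0 subnK// => /(_ erefl).
  apply: eq_integrable => [|w _]; first exact: measurable_eball.
  by rewrite /= expr0 mul1r.
move=> t; have := moment_dotv (v + t *: y) ik d0 s0.
rewrite doubleS => h.
under eq_Rintegral do rewrite -dotvZl -dotvDl.
rewrite h /P !hornerE; congr (_ ^+ _ * _).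
by rewrite !(dotvDl, dotvDr, dotvZl, dotvZr) (dotvC y v); ring.
Qed.

(** A second polarization, of [moment_dotv1] along [z]. By orthogonality [|v + t z|^2] has no term
    of first order, so only the linear factor [dotv (v + t z) y] contributes; the division by
    [2 k + 1] undoes the binomial factor. *)
Lemma moment_dotv2 d a k i v y z : 0 < d -> dotv v z = 0 ->
  0 < N%:R + 2 * (i + k.+1)%:R - a ->
  \int[leb]_(w in eball d) (dotv v w ^+ k.*2 * dotv z w * (dotv y w * weight i a w)) =
  dotv v v ^+ k * dotv z y * moment d a k.+1 i / k.*2.+1%:R.
Proof.
move=> d0 vz s0.
have ik : (0 < i + k.+1)%N by rewrite addnS.
pose P := ((dotv v v)%:P + 'X^2 * (dotv z z)%:P) ^+ k * ((dotv v y)%:P + 'X * (dotv z y)%:P)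
   * (moment d a k.+1 i)%:P.
have := @Rintegral_pow_coef1 _ _ _ leb _ (measurable_eball d) k.*2
  (dotv v) (dotv z) (fun w => dotv y w * weight i a w) P.
have -> : P`_1 = dotv v v ^+ k * dotv z y * moment d a k.+1 i.
  rewrite coef1_deriv /P derivM derivC mulr0 addr0 derivM deriv_exp.
  rewrite !(poly.derivE, hornerE, hornerMn).
  by rewrite mul0rn mul0r add0r expr0n mul0r addr0.
move=> h; rewrite h; first by rewrite mulrC mulKf// pnatr_eq0.
  move=> q qk; have := @integrable_pow3_weight k.+1 i a d (k.*2.+1 - q) q 1 v z y ik d0 s0.
  rewrite subnK// addn1 => /(_ erefl).
  apply: eq_integrable => [|w _]; first exact: measurable_eball.
  by rewrite /= expr1.
move=> t; have -> : P.[t] = dotv (v + t *: z) (v + t *: z) ^+ k * dotv (v + t *: z) y *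
    moment d a k.+1 i.
  rewrite /P !hornerE; congr (_ ^+ _ * _ * _); last by rewrite dotvDl dotvZl.
  by rewrite !(dotvDl, dotvDr, dotvZl, dotvZr) (dotvC z v) vz; ring.
rewrite -moment_dotv1//; apply: eq_Rintegral => w _.
by rewrite dotvDl dotvZl mulrA.
Qed.

Lemma momentS d a k i : 0 < d -> 0 < N%:R + 2 * (i + k.+1)%:R - a ->
  (k.*2 + N)%:R * moment d a k.+1 i = k.*2.+1%:R * moment d a k i.+1.
Proof.
move=> d0 s0.
have e0v w : dotv (delta_mx ord0 ord0) w = w ord0 ord0 by rewrite dotvC dotv_delta.
pose e (j : 'I_N) : 'cV[R]_N := delta_mx j ord0.
have ee (j l : 'I_N) : dotv (e j) (e l) = (j == l)%:R.
  by rewrite dotv_delta mxE eqxx andbT eq_sym.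
have ik : (0 < i + k.+1)%N by rewrite addnS.
transitivity (k.*2.+1%:R * \sum_(j < N) \int[leb]_(w in eball d)
    (dotv (e ord0) w ^+ k.*2 * dotv (e j) w * (dotv (e j) w * weight i a w))).
  (* The term along the first axis is [M_(k+1)] and each of the [n] others is [M_(k+1) / (2 k + 1)],
     whence the factor [(2 k + 1) + n = 2 k + N]. *)
  rewrite big_ord_recl.
  have -> : \int[leb]_(w in eball d) (dotv (e ord0) w ^+ k.*2 * dotv (e ord0) w *
      (dotv (e ord0) w * weight i a w)) = moment d a k.+1 i.
    apply: eq_Rintegral => w _; rewrite e0v doubleS !exprSr; ring.
  rewrite (eq_bigr (fun=> moment d a k.+1 i / k.*2.+1%:R)) => [|j _]; last first.
    by rewrite moment_dotv2// ?ee// !eqxx expr1n !mul1r.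
  rewrite sumr_const card_ord -[X in _ * (_ + X)]mulr_natl -addSnnS natrD.
  by field; rewrite nat1r pnatr_eq0.
rewrite -Rintegral_sum.
- congr (_ * _); apply: eq_Rintegral => w _; rewrite weightS.
  rewrite [dotv w w]/dotv mulr_suml mulr_sumr; apply: eq_bigr => j _.
  by rewrite /e e0v (dotvC _ w) dotv_delta; ring.
- exact: measurable_eball.
- move=> j; have := @integrable_pow3_weight k.+1 i a d k.*2 1 1 (e ord0) (e j) (e j) ik d0 s0.
  rewrite -addnA addn2 => /(_ erefl).
  apply: eq_integrable => [|w _]; first exact: measurable_eball.
  by rewrite /= !expr1.
Qed.

End moments.

(** * Closed forms *)

Section pochhammer.
Context {R : realType}.
Implicit Types (a b : R) (k : nat).

Lemma poch0 a : poch a 0 = 1.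
Proof. by rewrite /poch big_ord0. Qed.

Lemma pochS a k : poch a k.+1 = poch a k * (a + k%:R).
Proof. by rewrite /poch big_ord_recr. Qed.

Lemma poch_gt0 a k : 0 < a -> 0 < poch a k.
Proof. by move=> a0; apply: prodr_gt0 => i _; rewrite ltr_pwDl. Qed.

Lemma natr_factS k : k.+1`!%:R = k.+1%:R * k`!%:R :> R.
Proof. by rewrite factS natrM. Qed.

Lemma poch1 k : poch (1 : R) k = k`!%:R.
Proof.
elim: k => [|k IH]; first by rewrite poch0.
by rewrite pochS IH factS mulnC natrM nat1r.
Qed.

Lemma poch2 k : poch (2 : R) k = k.+1`!%:R.
Proof.
elim: k => [|k IH]; first by rewrite poch0.
by rewrite pochS IH [k.+2`!]factS mulnC natrM -natrD.
Qed.

Lemma poch_shift b k : poch b k * (b + k%:R) = b * poch (b + 1) k.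
Proof.
elim: k => [|k IH]; first by rewrite !poch0 addr0 mulrC.
by rewrite !pochS IH -natr1; ring.
Qed.

(** The mean over the unit sphere of R^N of the power [2 k] of one coordinate: 1, 3, ..., 2k - 1
    multiplied together, over N, N + 2, ..., N + 2k - 2. *)
Definition odd_ratio (N k : nat) : R := \prod_(l < k) (l.*2.+1%:R / (l.*2 + N)%:R).

Lemma odd_ratioS N k : odd_ratio N k.+1 = odd_ratio N k * (k.*2.+1%:R / (k.*2 + N)%:R).
Proof. by rewrite /odd_ratio big_ord_recr. Qed.

(** Matches the spherical mean and the factorial of the sine series with the Pochhammer symbols of
    the series squared in [lambda1]; [odd_ratio_fact2] does the same for the series with kernel
    exponent [beta + 2]. *)
Lemma odd_ratio_fact1 N k : (0 < N)%N ->
  odd_ratio N k.+1 * N%:R * (4 ^+ k * k`!%:R * poch ((N%:R + 2) / 2) k) =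
  k.*2.+1`!%:R.
Proof.
move=> N0; have Nn0 : N%:R != 0 :> R by rewrite pnatr_eq0 -lt0n.
elim: k => [|k IH].
  by rewrite odd_ratioS /odd_ratio big_ord0 poch0 expr0 double0 add0n fact0 (_ : 1`! = 1)%N//; field.
rewrite odd_ratioS pochS exprS (natr_factS k) doubleS.
rewrite (natr_factS k.*2.+2) (natr_factS k.*2.+1) -IH.
have kN : (k.*2.+2 + N)%:R != 0 :> R by rewrite pnatr_eq0 addn_eq0 negb_and -!lt0n N0 orbT.
have -> : (N%:R + 2) / 2 + k%:R = (k.*2.+2 + N)%:R / 2 :> R.
  by rewrite natrD -(doubleS k) -mul2n natrM -natr1; field.
have -> : k.*2.+2%:R = 2 * k.+1%:R :> R by rewrite -(doubleS k) -mul2n natrM.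
by field.
Qed.

Lemma odd_ratio_fact2 N k : (0 < N)%N ->
  odd_ratio N k.+2 * (2 * N%:R * (N%:R + 2)) *
    (4 ^+ k * k.+1`!%:R * poch ((N%:R + 4) / 2) k) =
  k.*2.+3%:R * k.*2.+2`!%:R.
Proof.
move=> N0; have Nn0 : N%:R != 0 :> R by rewrite pnatr_eq0 -lt0n.
elim: k => [|k IH].
  rewrite !odd_ratioS /odd_ratio big_ord0 poch0 expr0 !doubleS !double0 add0n natrD.
  have N2 : 2 + N%:R != 0 :> R by rewrite -natrD pnatr_eq0.
  rewrite (_ : 2`! = 2)%N// (_ : 1`! = 1)%N//; field.
  by rewrite N2 Nn0.
rewrite odd_ratioS pochS exprS (natr_factS k.+1) !doubleS.
rewrite (natr_factS k.*2.+3) (natr_factS k.*2.+2).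
have kN : (k.*2.+4 + N)%:R != 0 :> R by rewrite pnatr_eq0 addn_eq0 negb_and -!lt0n N0 orbT.
have -> : (N%:R + 4) / 2 + k%:R = (k.*2.+4 + N)%:R / 2 :> R.
  by rewrite natrD -2!doubleS -mul2n natrM -!natr1; field.
rewrite [RHS](_ : _ = k.*2.+4.+1%:R * k.*2.+4%:R * (k.*2.+3%:R * k.*2.+2`!%:R)); last by ring.
rewrite -IH.
have -> : k.*2.+4%:R = 2 * k.+2%:R :> R by rewrite -natrM mul2n !doubleS.
by field.
Qed.

End pochhammer.

Section radial_values.
Context {R : realType} {n : nat}.
Notation N := n.+1.
Notation leb := (lebesgue_cV N : {measure set 'cV[R]_N -> \bar R}).
Implicit Types (a d : R) (j k i : nat).

Lemma moment_radial d a k i : 0 < d -> (0 < i + k)%N ->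
  0 < N%:R + 2 * (i + k)%:R - a ->
  moment (n := n) d a k i =
  odd_ratio N k * \int[leb]_(w in eball d) weight (i + k) a w.
Proof.
move=> d0; elim: k i => [|k IH] i ik s0.
  rewrite /odd_ratio big_ord0 mul1r addn0.
  by apply: eq_Rintegral => w _; rewrite expr0 mul1r.
have kN : (k.*2 + N)%:R != 0 :> R by rewrite pnatr_eq0 addnS.
apply: (mulfI kN); rewrite momentS// IH ?addSnnS//.
by rewrite odd_ratioS; field.
Qed.

(** The iterated recursion telescopes: only the first and the last degree of homogeneity survive. *)
Lemma weight_int_add d a j k : 0 < d -> (0 < j)%N ->
  0 < N%:R + 2 * j%:R - a ->
  (N%:R + 2 * j%:R - a + 2 * k%:R) * \int[leb]_(w in eball d) weight (j + k) a w =
  d ^+ k.*2 * (N%:R + 2 * j%:R - a) * \int[leb]_(w in eball d) weight j a w.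
Proof.
move=> d0 j0 s0; elim: k => [|k IH]; first by rewrite mulr0 addr0 addn0 expr0 mul1r.
have jk : (0 < j + k)%N by rewrite addn_gt0 j0.
have sk : 0 < N%:R + 2 * (j + k)%:R - a.
  by rewrite natrD; have := ler0n R k; lra.
have := weight_int_rec jk d0 sk; rewrite addnS.
have -> : N%:R + 2 * (j + k)%:R - a = N%:R + 2 * j%:R - a + 2 * k%:R.
  by rewrite natrD; ring.
have -> : N%:R + 2 * j%:R - a + 2 * k%:R + 2 = N%:R + 2 * j%:R - a + 2 * k.+1%:R.
  by rewrite -natr1; ring.
move=> ->; rewrite mulrCA IH doubleS !exprS; ring.
Qed.

End radial_values.

(** * Termwise integration *)

Section series.
Context {R : realType}.
Implicit Types u : nat -> R.

Lemma series_shift u m : series (fun k => u k.+1) m = series u m.+1 - u 0%N.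
Proof. by rewrite /series/= big_nat_recl// addrC addKr. Qed.

Lemma cvg_series_shift u l : series u @ \oo --> l ->
  series (fun k => u k.+1) @ \oo --> l - u 0%N.
Proof.
move=> ul; rewrite (_ : series _ = fun m => series u m.+1 - u 0%N).
  by apply: cvgB; [rewrite (cvg_shiftS (series u))|exact: cvg_cst].
by apply/funext => m; exact: series_shift.
Qed.

Lemma cvg_seriesZ c u l : series u @ \oo --> l ->
  series (fun k => c * u k) @ \oo --> c * l.
Proof.
move=> ul; rewrite (_ : series _ = fun m => c * series u m).
  by apply: cvgM => //; exact: cvg_cst.
by apply/funext => m; rewrite /series/= mulr_sumr.
Qed.

Lemma series_scale_lim (c l : R) u :
  series (fun k => c * u k) @ \oo --> l -> l = c * limn (series u).
Proof.
(* For [c = 0] nothing is known about the convergence of [u], but [limn] still has some value and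
   the factor 0 removes it. *)
have [->|c0] := eqVneq c 0.
  move=> h; rewrite mul0r; apply: (cvg_unique _ h) => //.
  rewrite (_ : series _ = fun=> 0); first exact: cvg_cst.
  by apply/funext => m; rewrite /series/= big1// => k _; rewrite mul0r.
move=> /(@cvg_seriesZ c^-1) h; rewrite -[LHS](mulVKf c0); congr (_ * _).
apply/esym/cvg_lim => //.
by move: h; under eq_fun do rewrite mulKf//.
Qed.

Lemma sum_exp_coeff_le (x : R) m : 0 <= x ->
  \sum_(0 <= k < m) (x ^+ k / k`!%:R) <= expR x.
Proof.
move=> x0; rewrite /expR.
apply: (@nondecreasing_cvgn_le _ (series (exp_coeff x))).
  apply/nondecreasing_seqP => k; rewrite /series/= big_nat_recr//= lerDl.
  by rewrite /exp_coeff/= divr_ge0// exprn_ge0.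
exact: is_cvg_series_exp_coeff.
Qed.

(** The power of [t] that tames the kernel at the origin is kept as a separate factor, the form in
    which [power_series_integral] takes its series; the next two expansions follow the same
    pattern. *)
Lemma cvg_cos_sub1 (t : R) :
  series (fun k => (-1) ^+ k.+1 / k.*2.+2`!%:R * t ^+ k.*2 * t ^+ 2) @ \oo --> cos t - 1.
Proof.
rewrite (_ : (fun k => _) = (fun k => cos_coeff' t k.+1)); last first.
  apply/funext => k; rewrite /cos_coeff' doubleS -exprnP -(addn2 k.*2) exprD.
  by ring.
have -> : cos t - 1 = cos t - cos_coeff' t 0.
  by rewrite /cos_coeff' expr0z expr0 fact0 divr1 mulr1.
exact: cvg_series_shift (@cvg_cos_coeff' R t).
Qed.

Lemma cvg_sin_odd (t : R) :
  series (fun k => (-1) ^+ k / k.*2.+1`!%:R * t ^+ k.*2 * t ^+ 1) @ \oo --> sin t.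
Proof.
rewrite (_ : (fun k => _) = sin_coeff' t); first exact: cvg_sin_coeff'.
by apply/funext => k; rewrite /sin_coeff' -exprnP -(addn1 k.*2) exprD; ring.
Qed.

Lemma cvg_sin_subid (t : R) :
  series (fun k => (-1) ^+ k.+1 / k.*2.+3`!%:R * t ^+ k.*2 * t ^+ 3) @ \oo --> sin t - t.
Proof.
rewrite (_ : (fun k => _) = (fun k => sin_coeff' t k.+1)); last first.
  apply/funext => k; rewrite /sin_coeff' doubleS -exprnP -(addn3 k.*2) exprD.
  by ring.
have -> : sin t - t = sin t - sin_coeff' t 0.
  by rewrite /sin_coeff' expr0z expr1 (_ : 1`! = 1)%N// divr1 mul1r.
exact: cvg_series_shift (@cvg_sin_coeff' R t).
Qed.

End series.

Section dominated_series.
Context d (T : measurableType d) (R : realType) (mu : {measure set T -> \bar R}).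
Variables (D : set T) (mD : measurable D).
Variables (f_ : nat -> T -> R) (f g : T -> R) (b : nat -> R) (B : R).
Hypothesis mf_ : forall k, measurable_fun D (f_ k).
Hypothesis f_f : forall x, D x -> series (fun k => f_ k x) @ \oo --> f x.
Hypothesis ig : mu.-integrable D (EFin \o g).
Hypothesis f_g : forall k x, D x -> `|f_ k x| <= b k * g x.
Hypothesis g0 : forall x, D x -> 0 <= g x.
Hypothesis bB : forall m, \sum_(0 <= k < m) b k <= B.

Let S m x := series (fun k => f_ k x) m.

Let mS m : measurable_fun D (EFin \o S m).
Proof. by apply/measurable_EFinP; exact: measurable_sum. Qed.

Let S_f x : D x -> (EFin \o S m) x @[m --> \oo] --> (EFin \o f) x.
Proof. by move=> Dx; apply: cvg_EFin; [exact: nearW|exact: f_f]. Qed.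

Let iBg : mu.-integrable D (EFin \o (fun x => B * g x)).
Proof. exact: integrable_scale. Qed.

Let S_g m x : D x -> (`|(EFin \o S m) x| <= (EFin \o (fun x => (B * g x)%R)) x)%E.
Proof.
move=> Dx; rewrite /= lee_fin /S /series/=; apply: le_trans (ler_norm_sum _ _ _) _.
apply: le_trans (ler_sum _ (fun k _ => f_g k Dx)) _.
by rewrite -mulr_suml; apply: ler_wpM2r; [exact: g0|exact: bB].
Qed.

Let mf : measurable_fun D (EFin \o f).
Proof. exact: (emeasurable_fun_cvg _ _ mS S_f). Qed.

Let dct := @dominated_convergence _ _ _ mu D mD (fun m => EFin \o S m) (EFin \o f)
  (EFin \o (fun x => B * g x)) mS mf (aeW _ S_f) iBg (aeW _ (fun x m => S_g m (x := x))).

Lemma dominated_series_integrable : mu.-integrable D (EFin \o f).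
Proof. by case: dct. Qed.

Lemma dominated_series_cvg :
  series (fun k => \int[mu]_(x in D) f_ k x) @ \oo --> \int[mu]_(x in D) f x.
Proof.
have if_ k : mu.-integrable D (EFin \o f_ k).
  apply: (le_integrable mD _ _ (integrable_scale mD (b k) ig)).
    by apply/measurable_EFinP.
  by move=> x Dx; rewrite /= lee_fin (le_trans (f_g k Dx))// ler_norm.
rewrite (_ : series _ = fun m => \int[mu]_(x in D) S m x); last first.
  by apply/funext => m; rewrite /series/= /S Rintegral_sum.
apply: fine_cvg; rewrite fineK.
  by case: dct.
exact: integrable_fin_num dominated_series_integrable.
Qed.

End dominated_series.

Section power_series_integral.
Context {R : realType} {n : nat}.
Notation N := n.+1.
Notation leb := (lebesgue_cV N : {measure set 'cV[R]_N -> \bar R}).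
Variables (g : R -> R) (s : nat -> R) (p q r m : nat) (a d : R).
Variables (v z y : 'cV[R]_N).
Hypothesis s_le : forall k, `|s k| <= k`!%:R^-1.
Hypothesis s_g : forall t, series (fun k => s k * t ^+ k.*2 * t ^+ p) @ \oo --> g t.
Hypothesis pqr : (p + q + r = m.*2)%N.
Hypotheses (m0 : (0 < m)%N) (d0 : 0 < d) (dim0 : 0 < N%:R + 2 * m%:R - a).

Let F w := g (dotv v w) * (dotv z w ^+ q * (dotv y w ^+ r * weight 0 a w)).

Let F_ k w := s k *
  (dotv v w ^+ (k.*2 + p) * dotv z w ^+ q * (dotv y w ^+ r * weight 0 a w)).

(** On the ball [(dotv v w)^(2k) <= T^k], so with [|s k| <= 1 / k!] the series is dominated, up to
    the integrable factor [C * weight m a], by that of [expR T]. *)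
Let T := (enorm v * d) ^+ 2.

Let b k := (T ^+ k / k`!%:R).

Let C := enorm v ^+ p * enorm z ^+ q * enorm y ^+ r.

Let T0 : 0 <= T. Proof. exact: sqr_ge0. Qed.

Let C0 : 0 <= C. Proof. by rewrite !mulr_ge0 ?exprn_ge0 ?enorm_ge0. Qed.

Let mF_ k : measurable_fun (eball d) (F_ k).
Proof.
apply: measurable_funTS; apply: measurable_funM => //.
exact: (measurable_pow3_weight 0 a (k.*2 + p) q r v z y).
Qed.

Let F_F w : eball d w -> series (fun k => F_ k w) @ \oo --> F w.
Proof.
move=> _; rewrite /F mulrC.
rewrite (_ : (fun k => _) = (fun k => dotv z w ^+ q * (dotv y w ^+ r * weight 0 a w) *
    (s k * dotv v w ^+ k.*2 * dotv v w ^+ p))); last first.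
  by apply/funext => k; rewrite /F_ exprD; ring.
exact: cvg_seriesZ.
Qed.

Let F_le k w : eball d w -> `|F_ k w| <= b k * (C * weight m a w).
Proof.
move=> wd; rewrite /F_ exprD normrM.
have -> : dotv v w ^+ k.*2 * dotv v w ^+ p * dotv z w ^+ q *
    (dotv y w ^+ r * weight 0 a w) =
    (dotv v w ^+ 2) ^+ k * (dotv v w ^+ p * dotv z w ^+ q * (dotv y w ^+ r * weight 0 a w)).
  by rewrite -exprM mul2n; ring.
rewrite normrM mulrA; apply: ler_pM; rewrite ?mulr_ge0//.
  rewrite /b mulrC; apply: ler_pM => //.
  rewrite normrX lerXn2r ?nnegrE// /T normrX lerXn2r ?nnegrE ?mulr_ge0 ?enorm_ge0 ?(ltW d0)//.
  apply: (le_trans (cauchy_schwarz v w)).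
  by apply: ler_wpM2l; [exact: enorm_ge0|exact: ltW].
exact: (normr_pow3_weight 0 a v z y w pqr).
Qed.

Let iW : leb.-integrable (eball d) (EFin \o (fun w => C * weight m a w)).
Proof.
by apply: integrable_scale; [exact: measurable_eball|exact: integrable_weight].
Qed.

Let W0 (w : 'cV[R]_N) : eball d w -> 0 <= C * weight m a w.
Proof. by move=> _; rewrite mulr_ge0// weight_ge0. Qed.

Let b_le M : \sum_(0 <= k < M) b k <= expR T.
Proof. exact: sum_exp_coeff_le. Qed.

Lemma power_series_integrable : leb.-integrable (eball d) (EFin \o F).
Proof.
exact: (dominated_series_integrable (measurable_eball d) mF_ F_F iW F_le W0 b_le).
Qed.

(** Reduces the evaluation of an integral to an identity between coefficients: [K] is the
    normalization of the integral, [X] the prefactor of the answer and [u] the terms of the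
    hypergeometric series. *)
Lemma power_series_value (K X : R) (u : nat -> R) :
  (forall k, K * (s k * \int[leb]_(w in eball d) (dotv v w ^+ (k.*2 + p) *
    dotv z w ^+ q * (dotv y w ^+ r * weight 0 a w))) = X * u k) ->
  K * \int[leb]_(w in eball d) F w = X * limn (series u).
Proof.
move=> KX; apply: series_scale_lim.
have := cvg_seriesZ (c := K)
  (dominated_series_cvg (measurable_eball d) mF_ F_F iW F_le W0 b_le).
rewrite (_ : (fun k => _) = (fun k => X * u k))//.
apply/funext => k; rewrite -KX RintegralZl//; first exact: measurable_eball.
have kpqr : (k.*2 + p + q + r = (k + m).*2)%N by rewrite doubleD -pqr !addnA.
have km : (0 < 0 + (k + m))%N by rewrite add0n addn_gt0 m0 orbT.
have dimkm : 0 < N%:R + 2 * (0 + (k + m))%:R - a.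
  by rewrite add0n natrD; move: dim0; have := ler0n R k; lra.
exact: (integrable_pow3_weight (n := n) v z y km d0 dimkm kpqr).
Qed.

End power_series_integral.

(** * The even integrals as hypergeometric series *)

Section integral_values.
Context {R : realType} {n : nat}.
Notation N := n.+1.
Notation leb := (lebesgue_cV N : {measure set 'cV[R]_N -> \bar R}).
Variables (d beta : R).
Hypotheses (d0 : 0 < d) (dim0 : beta < N%:R + 2).
Implicit Types (v w y z nu : 'cV[R]_N) (k : nat).
Notation c := (@scaling_const R N d beta).
Notation b2 := (beta + 2).
Notation I1 := (\int[leb]_(w in eball d) weight 1 beta w).

Let alpha : R := N%:R + 2 - beta.

Let alpha0 : 0 < alpha. Proof. by rewrite /alpha subr_gt0. Qed.

Let alphak k : alpha + 2 * k%:R != 0.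
Proof. by rewrite gt_eqF// ltr_wpDr// mulr_ge0. Qed.

Let I1_gt0 : 0 < I1.
Proof. by apply: weight_int_gt0 => //; rewrite mulr1. Qed.

(** Every moment below is a multiple of the same [I1], so this normalization cancels it; of its
    value only the positivity is used. *)
Let scaling_constE : c = 2 * N%:R / I1.
Proof.
rewrite /scaling_const (_ : Rintegral _ _ _ = I1).
  by rewrite invfM invrK.
by apply: eq_Rintegral => w _; rewrite /weight expr1 sqr_enorm.
Qed.

Let moment_beta k : @moment R n d beta k.+1 0 =
  odd_ratio N k.+1 * (d ^+ k.*2 * alpha / (alpha + 2 * k%:R) * I1).
Proof.
rewrite moment_radial//; last first.
  by rewrite add0n -[k.+1]addn1 natrD; move: dim0; have := ler0n R k; lra.
congr (_ * _); apply: (mulfI (alphak k)); rewrite add0n -add1n.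
have := @weight_int_add R n d beta 1 k d0 (ltn0Sn _).
rewrite mulr1 => ->//.
by rewrite -/alpha; field; exact: alphak.
Qed.

Let moment_b2 k : @moment R n d b2 k.+2 0 =
  odd_ratio N k.+2 * (d ^+ k.*2 * alpha / (alpha + 2 * k%:R) * I1).
Proof.
rewrite moment_radial//; last first.
  by rewrite add0n -[k.+2]addn2 natrD; move: dim0; have := ler0n R k; lra.
congr (_ * _); apply: (mulfI (alphak k)); rewrite add0n.
have -> : \int[leb]_(w in eball d) weight k.+2 b2 w =
    \int[leb]_(w in eball d) weight k.+1 beta w.
  by apply: eq_Rintegral => w _; rewrite weightS2.
have := @weight_int_add R n d beta 1 k d0 (ltn0Sn _).
rewrite mulr1 add1n => ->//.
by rewrite -/alpha; field; exact: alphak.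
Qed.

Let NR : R := N%:R.

(** Pochhammer symbols of parameters differing by one telescope. This is how the radial factor
    [alpha / (alpha + 2 k)] becomes the pair of parameters containing [beta]. *)
Let pochb k : poch ((NR + 2 - beta) / 2) k / poch ((NR + 4 - beta) / 2) k =
  alpha / (alpha + 2 * k%:R).
Proof.
have b0 : 0 < (NR + 2 - beta) / 2 by rewrite divr_gt0.
have -> : (NR + 4 - beta) / 2 = (NR + 2 - beta) / 2 + 1 by field.
have p0 : poch ((NR + 2 - beta) / 2 + 1) k != 0.
  by rewrite gt_eqF// poch_gt0// addr_gt0.
have := poch_shift ((NR + 2 - beta) / 2) k.
have -> : (NR + 2 - beta) / 2 + k%:R = (alpha + 2 * k%:R) / 2.
  by rewrite /alpha; field.
move=> h; apply: (mulIf p0); rewrite divfK//.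
apply: (mulIf (_ : (alpha + 2 * k%:R) / 2 != 0)); first by rewrite mulf_neq0// invr_eq0.
rewrite h; rewrite -/alpha; field; exact: alphak.
Qed.

(** The pair [5/2] over [3/2] encodes the factor [(2 k + 3) / 3], by which the series of
    longitudinal and transverse modes differ. *)
Let poch32 k : poch (5 / 2 : R) k / poch (3 / 2) k = k.*2.+3%:R / 3.
Proof.
have p0 : poch (3 / 2 : R) k != 0 by rewrite gt_eqF// poch_gt0.
have := @poch_shift R (3 / 2) k.
have -> : 3 / 2 + 1 = 5 / 2 :> R by field.
have -> : 3 / 2 + k%:R = k.*2.+3%:R / 2 :> R.
  by rewrite -(addn3 k.*2) natrD -mul2n natrM; field.
move=> h; apply: (mulIf p0); rewrite divfK//.
have -> : poch (5 / 2 : R) k = 2 / 3 * (3 / 2 * poch (5 / 2) k) by field.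
by rewrite -h; field.
Qed.

Let hyp_argX nu k : hyp_arg d nu ^+ k = (-1) ^+ k * dotv nu nu ^+ k * d ^+ k.*2 / 4 ^+ k.
Proof.
have -> : hyp_arg d nu = -1 * dotv nu nu * d ^+ 2 / 4 by rewrite /hyp_arg sqr_enorm; field.
by rewrite 3!exprMn exprVn -exprM mul2n.
Qed.

Let T1 nu k : R := (\prod_(e <- [:: 1; 5 / 2; (NR + 2 - beta) / 2]) poch e k) /
  (\prod_(e <- [:: 2; 3 / 2; (NR + 4) / 2; (NR + 4 - beta) / 2]) poch e k) *
  (hyp_arg d nu ^+ k / k`!%:R).

Let T2 nu k : R := (\prod_(e <- [:: (NR + 2 - beta) / 2]) poch e k) /
  (\prod_(e <- [:: (NR + 2) / 2; (NR + 4 - beta) / 2]) poch e k) *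
  (hyp_arg d nu ^+ k / k`!%:R).

Let T3 nu k : R := (\prod_(e <- [:: 1; (NR + 2 - beta) / 2]) poch e k) /
  (\prod_(e <- [:: 2; (NR + 4) / 2; (NR + 4 - beta) / 2]) poch e k) *
  (hyp_arg d nu ^+ k / k`!%:R).

Let fact0 k : k`!%:R != 0 :> R.
Proof. by rewrite pnatr_eq0 -lt0n fact_gt0. Qed.

Let p4_0 k : poch ((NR + 4) / 2) k != 0.
Proof. by rewrite gt_eqF// poch_gt0// divr_gt0// addr_gt0. Qed.

Let p2_0 k : poch ((NR + 2) / 2) k != 0.
Proof. by rewrite gt_eqF// poch_gt0// divr_gt0// addr_gt0. Qed.

Let T3E nu k : T3 nu k = alpha / (alpha + 2 * k%:R) / (k.+1`!%:R * poch ((NR + 4) / 2) k) *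
  hyp_arg d nu ^+ k.
Proof.
rewrite /T3 !big_cons !big_nil poch1 poch2 -pochb.
have := fact0 k; have := fact0 k.+1; have := p4_0 k.
have : poch ((NR + 4 - beta) / 2) k != 0.
  by rewrite gt_eqF// poch_gt0// divr_gt0//; move: dim0; rewrite /NR; lra.
move: (poch _ k) (poch _ k) (poch _ k) => A B C A0 C0 f1 f0.
by field; rewrite A0 C0 f1 f0.
Qed.

Let T1E nu k : T1 nu k = k.*2.+3%:R / 3 * T3 nu k.
Proof.
rewrite /T1 /T3 !big_cons !big_nil -poch32.
have := fact0 k; have : poch (2 : R) k != 0 by rewrite poch2.
have := p4_0 k; have : poch (3 / 2 : R) k != 0 by rewrite gt_eqF// poch_gt0.
have : poch ((NR + 4 - beta) / 2) k != 0.
  by rewrite gt_eqF// poch_gt0// divr_gt0//; move: dim0; rewrite /NR; lra.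
move: (poch _ k) (poch _ k) (poch _ k) (poch _ k) (poch _ k) (poch _ k).
move=> A B C D E F A0 B0 C0 f1 f0.
by field; rewrite ?A0 ?B0 ?C0 ?f1 ?f0.
Qed.

Let T2E nu k : T2 nu k = alpha / (alpha + 2 * k%:R) / (k`!%:R * poch ((NR + 2) / 2) k) *
  hyp_arg d nu ^+ k.
Proof.
rewrite /T2 !big_cons !big_nil -pochb.
have := fact0 k; have := p2_0 k.
have : poch ((NR + 4 - beta) / 2) k != 0.
  by rewrite gt_eqF// poch_gt0// divr_gt0//; move: dim0; rewrite /NR; lra.
move: (poch _ k) (poch _ k) (poch _ k) => A B C A0 C0 f0.
by field; rewrite A0 C0 f0.
Qed.

(** Serves all three integrals with kernel exponent [beta + 2]: the parallel case keeps the factor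
    [2 k + 3], the other two divide it out. *)
Let cos_coef k nu :
  (NR + 2) * c * ((-1) ^+ k.+1 / k.*2.+2`!%:R * (dotv nu nu ^+ k.+1 * @moment R n d b2 k.+2 0)) =
  - dotv nu nu * (k.*2.+3%:R * T3 nu k).
Proof.
rewrite scaling_constE moment_b2 T3E hyp_argX.
have N0 : NR != 0 by rewrite pnatr_eq0.
have := odd_ratio_fact2 (R := R) k (ltn0Sn n); rewrite -/NR => h.
have f2 := fact0 k.*2.+2; have f1 := fact0 k.+1; have p4 := p4_0 k.
have x4 : 4 ^+ k != 0 :> R by rewrite expf_neq0.
have I0 : I1 != 0 by rewrite gt_eqF.
have Nn : NR + 2 != 0 by rewrite gt_eqF// addr_gt0.
have -> : odd_ratio N k.+2 = k.*2.+3%:R * k.*2.+2`!%:R /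
    (2 * NR * (NR + 2) * (4 ^+ k * k.+1`!%:R * poch ((NR + 4) / 2) k)) :> R.
  rewrite -h; field.
  by rewrite nat1r -/NR p4 f1 x4 Nn N0.
rewrite -/NR !exprS.
have ak := alphak k.
field.
by rewrite ?nat1r -/NR ?p4 ?f1 ?f2 ?x4 ?Nn ?N0 ?I0 ?ak.
Qed.

Let sin_coef k nu :
  c / 2 * ((-1) ^+ k / k.*2.+1`!%:R * (dotv nu nu ^+ k * @moment R n d beta k.+1 0)) = T2 nu k.
Proof.
rewrite scaling_constE moment_beta T2E hyp_argX.
have N0 : NR != 0 by rewrite pnatr_eq0.
have := odd_ratio_fact1 (R := R) k (ltn0Sn n); rewrite -/NR => h.
have f2 := fact0 k.*2.+1; have f1 := fact0 k; have p2 := p2_0 k.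
have x4 : 4 ^+ k != 0 :> R by rewrite expf_neq0.
have I0 : I1 != 0 by rewrite gt_eqF.
have -> : odd_ratio N k.+1 = k.*2.+1`!%:R /
    (NR * (4 ^+ k * k`!%:R * poch ((NR + 2) / 2) k)) :> R.
  rewrite -h; field.
  by rewrite nat1r -/NR p2 f1 x4 N0.
rewrite -/NR; have ak := alphak k.
field.
by rewrite ?nat1r -/NR ?p2 ?f1 ?f2 ?x4 ?N0 ?I0 ?ak.
Qed.

Let fact_le k l (e : nat) : (k <= l)%N -> `|(-1) ^+ e / l`!%:R| <= k`!%:R^-1 :> R.
Proof.
move=> kl; rewrite normrM normrX normrN1 expr1n mul1r ger0_norm ?invr_ge0//.
by rewrite lef_pV2 ?posrE ?ltr0n ?fact_gt0// ler_nat leq_fact.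
Qed.

Let b2_dim : 0 < N%:R + 2 * 2%:R - b2.
Proof. by move: dim0; lra. Qed.

Let beta_dim : 0 < N%:R + 2 * 1%:R - beta.
Proof. by move: dim0; lra. Qed.

(** This and [sin_integrand] are the even parts of the integrands of the operator on the mode of
    frequency [nu]: [z] is its amplitude, and the vector in the last linear factor will be a
    coordinate direction or an amplitude. *)
Definition cos_integrand nu z y w : R :=
  (cos (dotv nu w) - 1) * (dotv z w * dotv y w / enorm w `^ b2).

Definition sin_integrand nu y w : R :=
  sin (dotv nu w) * (dotv y w / enorm w `^ beta).

Definition sin_subid_integrand nu w : R :=
  (sin (dotv nu w) - dotv nu w) * (dotv nu w / enorm w `^ b2).

Let cos_integrandE nu z y : cos_integrand nu z y = fun w =>
  (cos (dotv nu w) - 1) * (dotv z w ^+ 1 * (dotv y w ^+ 1 * weight 0 b2 w)).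
Proof. by apply/funext => w; congr (_ * _); rewrite !expr1 /weight expr0 mul1r mulrA. Qed.

Let sin_integrandE nu y : sin_integrand nu y = fun w =>
  sin (dotv nu w) * (dotv nu w ^+ 0 * (dotv y w ^+ 1 * weight 0 beta w)).
Proof. by apply/funext => w; rewrite expr0 expr1 /weight expr0 !mul1r. Qed.

Let sin_subid_integrandE nu : sin_subid_integrand nu = fun w =>
  (sin (dotv nu w) - dotv nu w) * (dotv nu w ^+ 0 * (dotv nu w ^+ 1 * weight 0 b2 w)).
Proof. by apply/funext => w; rewrite expr0 expr1 /weight expr0 !mul1r. Qed.

Let k22 k : (k <= k.*2.+2)%N.
Proof. by rewrite -addnn; apply: leq_trans (leq_addr _ _) _; rewrite !leqW. Qed.

Lemma cos_integrable nu z y :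
  leb.-integrable (eball d) (EFin \o cos_integrand nu z y).
Proof.
rewrite cos_integrandE.
apply: (@power_series_integrable R n (fun t => cos t - 1)
  (fun k => (-1) ^+ k.+1 / k.*2.+2`!%:R) 2 1 1 2) => //.
- by move=> k; exact: fact_le.
- exact: cvg_cos_sub1.
Qed.

Lemma sin_integrable nu y :
  leb.-integrable (eball d) (EFin \o sin_integrand nu y).
Proof.
rewrite sin_integrandE.
apply: (@power_series_integrable R n sin
  (fun k => (-1) ^+ k / k.*2.+1`!%:R) 1 0 1 1) => //.
- by move=> k; apply: fact_le; rewrite -addnn leqW// leq_addr.
- exact: cvg_sin_odd.
Qed.

Lemma sin_subid_integrable nu :
  leb.-integrable (eball d) (EFin \o sin_subid_integrand nu).
Proof.
rewrite sin_subid_integrandE.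
apply: (@power_series_integrable R n (fun t => sin t - t)
  (fun k => (-1) ^+ k.+1 / k.*2.+3`!%:R) 3 0 1 2) => //.
- by move=> k; apply: fact_le; exact/leqW.
- exact: cvg_sin_subid.
Qed.

Lemma cos_parallel_value nu y :
  (NR + 2) * c * \int[leb]_(w in eball d) cos_integrand nu nu y w =
  - (3 * dotv nu nu * dotv nu y) *
  hypergeom [:: 1; 5 / 2; (NR + 2 - beta) / 2]
    [:: 2; 3 / 2; (NR + 4) / 2; (NR + 4 - beta) / 2] (hyp_arg d nu).
Proof.
rewrite cos_integrandE.
apply: (@power_series_value R n (fun t => cos t - 1)
  (fun k => (-1) ^+ k.+1 / k.*2.+2`!%:R) 2 1 1 2 b2 d nu nu y _ _ _ _ d0 b2_dim
  ((NR + 2) * c) _ (T1 nu)) => //.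
- by move=> k; exact: fact_le.
- exact: cvg_cos_sub1.
move=> k; rewrite T1E.
have -> : \int[leb]_(w in eball d) (dotv nu w ^+ (k.*2 + 2) * dotv nu w ^+ 1 *
    (dotv y w ^+ 1 * weight 0 b2 w)) =
    dotv nu nu ^+ k.+1 * dotv nu y * @moment R n d b2 k.+2 0.
  rewrite -moment_dotv1//; last by rewrite add0n -[k.+2]addn2 natrD; move: dim0; have := ler0n R k; lra.
  by apply: eq_Rintegral => w _; rewrite -exprD addn2 addn1 expr1 doubleS mulrA.
rewrite -[LHS](_ : dotv nu y * ((NR + 2) * c * ((-1) ^+ k.+1 / k.*2.+2`!%:R *
  (dotv nu nu ^+ k.+1 * @moment R n d b2 k.+2 0))) = _); last by ring.
by rewrite cos_coef; field.
Qed.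

Lemma cos_orthogonal_value nu z y : dotv nu z = 0 ->
  (NR + 2) * c * \int[leb]_(w in eball d) cos_integrand nu z y w =
  - (dotv nu nu * dotv z y) *
  hypergeom [:: 1; (NR + 2 - beta) / 2]
    [:: 2; (NR + 4) / 2; (NR + 4 - beta) / 2] (hyp_arg d nu).
Proof.
move=> nuz; rewrite cos_integrandE.
apply: (@power_series_value R n (fun t => cos t - 1)
  (fun k => (-1) ^+ k.+1 / k.*2.+2`!%:R) 2 1 1 2 b2 d nu z y _ _ _ _ d0 b2_dim
  ((NR + 2) * c) _ (T3 nu)) => //.
- by move=> k; exact: fact_le.
- exact: cvg_cos_sub1.
move=> k.
have -> : \int[leb]_(w in eball d) (dotv nu w ^+ (k.*2 + 2) * dotv z w ^+ 1 *
    (dotv y w ^+ 1 * weight 0 b2 w)) =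
    dotv nu nu ^+ k.+1 * dotv z y * @moment R n d b2 k.+2 0 / k.*2.+3%:R.
  rewrite -[k.*2.+3]/(k.+1.*2.+1) -moment_dotv2//; last first.
    by rewrite add0n -[k.+2]addn2 natrD; move: dim0; have := ler0n R k; lra.
  by apply: eq_Rintegral => w _; rewrite addn2 !expr1.
have k3 : k.*2.+3%:R != 0 :> R by rewrite pnatr_eq0.
rewrite -[LHS](_ : dotv z y * ((NR + 2) * c * ((-1) ^+ k.+1 / k.*2.+2`!%:R *
  (dotv nu nu ^+ k.+1 * @moment R n d b2 k.+2 0))) / k.*2.+3%:R = _); last by ring.
by rewrite cos_coef; field.
Qed.

Lemma sin_value nu y :
  c / 2 * \int[leb]_(w in eball d) sin_integrand nu y w =
  dotv nu y * hypergeom [:: (NR + 2 - beta) / 2]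
    [:: (NR + 2) / 2; (NR + 4 - beta) / 2] (hyp_arg d nu).
Proof.
rewrite sin_integrandE.
apply: (@power_series_value R n sin
  (fun k => (-1) ^+ k / k.*2.+1`!%:R) 1 0 1 1 beta d nu nu y _ _ _ _ d0 beta_dim
  (c / 2) _ (T2 nu)) => //.
- by move=> k; apply: fact_le; rewrite -addnn leqW// leq_addr.
- exact: cvg_sin_odd.
move=> k.
have -> : \int[leb]_(w in eball d) (dotv nu w ^+ (k.*2 + 1) * dotv nu w ^+ 0 *
    (dotv y w ^+ 1 * weight 0 beta w)) =
    dotv nu nu ^+ k * dotv nu y * @moment R n d beta k.+1 0.
  rewrite -moment_dotv1//; last first.
    by rewrite add0n -[k.+1]addn1 natrD; move: dim0; have := ler0n R k; lra.
  by apply: eq_Rintegral => w _; rewrite addn1 expr0 mulr1 expr1 mulrA.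
by rewrite -sin_coef; ring.
Qed.

(** The terms are those of the transverse cosine integral: the factor [1 / (2 k + 3)] that came
    there from orthogonality comes here from the factorial of [2 k + 3]. *)
Lemma sin_subid_value nu :
  (NR + 2) * c * \int[leb]_(w in eball d) sin_subid_integrand nu w =
  - (dotv nu nu * dotv nu nu) *
  hypergeom [:: 1; (NR + 2 - beta) / 2]
    [:: 2; (NR + 4) / 2; (NR + 4 - beta) / 2] (hyp_arg d nu).
Proof.
rewrite sin_subid_integrandE.
apply: (@power_series_value R n (fun t => sin t - t)
  (fun k => (-1) ^+ k.+1 / k.*2.+3`!%:R) 3 0 1 2 b2 d nu nu nu _ _ _ _ d0 b2_dim
  ((NR + 2) * c) _ (T3 nu)) => //.
- by move=> k; apply: fact_le; exact/leqW.
- exact: cvg_sin_subid.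
move=> k.
have -> : \int[leb]_(w in eball d) (dotv nu w ^+ (k.*2 + 3) * dotv nu w ^+ 0 *
    (dotv nu w ^+ 1 * weight 0 b2 w)) =
    dotv nu nu ^+ k.+1 * dotv nu nu * @moment R n d b2 k.+2 0.
  rewrite -moment_dotv1//; last first.
    by rewrite add0n -[k.+2]addn2 natrD; move: dim0; have := ler0n R k; lra.
  by apply: eq_Rintegral => w _; rewrite addn3 expr0 mulr1 expr1 doubleS mulrA.
have k3 : k.*2.+3%:R != 0 :> R by rewrite pnatr_eq0.
rewrite natr_factS invfM -[LHS](_ : dotv nu nu * ((NR + 2) * c * ((-1) ^+ k.+1 / k.*2.+2`!%:R *
  (dotv nu nu ^+ k.+1 * @moment R n d b2 k.+2 0))) / k.*2.+3%:R = _); last by ring.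
by rewrite cos_coef; field.
Qed.

End integral_values.

(** * Principal values *)

Section principal_value.
Context {R : realType} {n : nat}.
Notation leb := (lebesgue_cV n : {measure set 'cV[R]_n -> \bar R}).
Implicit Types (d e : R) (f : 'cV[R]_n -> R) (A : set 'cV[R]_n).

(* If the positive and negative parts have infinite integral, [fine] maps
   [+oo - +oo] to [0]. *)
Lemma Rintegral_odd A f : measurable A -> measurable_fun setT f ->
  (forall w, (- w \in A) = (w \in A)) -> (forall w, f (- w) = - f w) ->
  \int[leb]_(w in A) f w = 0.
Proof.
move=> mA mf sA oddf; pose F w := (f w)%:E.
have mF : measurable_fun setT F by apply/measurable_EFinP.
rewrite /Rintegral -/F integralE.
have -> : (\int[leb]_(w in A) F^\+ w = \int[leb]_(w in A) F^\- w)%E.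
  rewrite integral_mkcond [RHS]integral_mkcond.
  rewrite -[LHS]ge0_integral_cV_opp.
  - by apply: eq_integral => w _; rewrite /patch sA funeposE funenegE /F oddf EFinN.
  - by apply/(measurable_restrictT _ mA)/measurable_funTS/measurable_funepos.
  - by move=> w; rewrite patchE; case: ifPn.
have [X0|] := boolP ((\int[leb]_(w in A) F^\- w)%E \is a fin_num).
  by rewrite subee.
by case: (\int[leb]_(w in A) F^\- w)%E.
Qed.

Lemma integrable_annulus_le j a C d e f : 0 < e -> measurable_fun setT f ->
  (forall w, annulus e d w -> `|f w| <= C * weight j a w) ->
  leb.-integrable (annulus e d) (EFin \o f).
Proof.
move=> e0 mf fW; have mA := @measurable_annulus R n e d.
have iW : leb.-integrable (annulus e d) (EFin \o (fun w => C * weight j a w)).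
  apply: integrable_scale => //.
  apply: integrableS (integrable_weight_shell j a d e0) => //.
    exact: measurable_shell.
  by move=> w /andP[ew wd]; rewrite /shell/= wd ltW.
apply: (le_integrable mA _ _ iW).
  by apply: measurable_funTS; apply/measurable_EFinP.
by move=> w wA; rewrite /= lee_fin (le_trans (fW w wA))// ler_norm.
Qed.

(** Dominated convergence with bound [|f|]. The annuli never contain the origin, and [f 0 = 0] makes
    the truncations converge there too. *)
Lemma cvg_pv_approx d f : leb.-integrable (eball d) (EFin \o f) -> f 0 = 0 ->
  pv_approx d f @ 0^'+ --> \int[leb]_(w in eball d) f w.
Proof.
move=> fi f0; apply/cvg_at_rightP => u [u0 ul].
have mB := @measurable_eball R n d.
pose g k w := (f \_ (annulus (u k) d)) w.
have Ad e : 0 < e -> annulus e d `<=` eball d by move=> _ w /andP[].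
have -> : (fun k => pv_approx d f (u k)) = fun k => \int[leb]_(w in eball d) g k w.
  apply/funext => k; rewrite /= /pv_approx /g -Rintegral_mkcondr setIC.
  by rewrite setIidl//; exact: Ad.
have [mf fy] := integrableP _ _ _ fi.
apply: fine_cvg; rewrite fineK; last exact: integrable_fin_num.
have gf w : eball d w -> (EFin \o g k) w @[k --> \oo] --> (EFin \o f) w.
  move=> wd; have [w0|w0] := eqVneq w 0.
    rewrite (_ : (fun k => _) = fun=> (EFin \o f) w); first exact: cvg_cst.
    by apply/funext => k; rewrite /= /g patchE w0 f0 if_same.
  apply: cvg_near_cst.
  have ew : 0 < enorm w by rewrite lt_neqAle enorm_ge0 eq_sym enorm_eq0 w0.
  have : \forall k \near \oo, u k < enorm w by exact: (cvgr_lt 0 ul).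
  apply: filterS => k ukw; rewrite /= /g patchE mem_set//.
  by rewrite /annulus/= ukw.
have [] := @dominated_convergence _ _ _ leb (eball d) mB (fun k => EFin \o g k)
  (EFin \o f) (abse \o (EFin \o f)).
- move=> k; rewrite (_ : EFin \o g k = (EFin \o f) \_ (annulus (u k) d)).
    apply/(measurable_restrict _ (measurable_annulus _ _) mB).
    by apply: measurable_funS mf => //; exact: subIsetr.
  by apply/funext => w; rewrite /= /g !patchE; case: ifPn.
- exact: mf.
- exact: aeW.
- exact: integrable_abse.
- apply: aeW => w k _; rewrite /= /g patchE; case: ifPn => // _.
  by rewrite normr0 lee_fin.
- by [].
Qed.

(** Both branches of [ball_int] are covered. On each annulus the odd part integrates to 0, so the
    truncated integrals are those of the even part, whose limit is its Lebesgue integral. *)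
Lemma ball_int_even_odd d (fe fo : 'cV[R]_n -> R) (a b : R) :
  leb.-integrable (eball d) (EFin \o fe) -> fe 0 = 0 ->
  measurable_fun setT fo -> (forall w, fo (- w) = - fo w) ->
  (forall e, 0 < e -> leb.-integrable (annulus e d) (EFin \o fo)) ->
  ball_int_defined d (fun w => a * fe w + b * fo w) /\
  ball_int d (fun w => a * fe w + b * fo w) = a * \int[leb]_(w in eball d) fe w.
Proof.
move=> ife fe0 mfo oddfo ifo.
pose fo' w := b * fo w.
have oddfo' w : fo' (- w) = - fo' w by rewrite /fo' oddfo mulrN.
have mfo' : measurable_fun setT fo' by apply: measurable_funM.
have mB := @measurable_eball R n d.
have iafe : leb.-integrable (eball d) (EFin \o (fun w => a * fe w)).
  exact: integrable_scale.
have pvE e : 0 < e -> pv_approx d (fun w => a * fe w + b * fo w) e =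
    pv_approx d (fun w => a * fe w) e.
  move=> e0; rewrite /pv_approx RintegralD.
  - rewrite [X in _ + X](@Rintegral_odd _ fo') ?addr0//.
      exact: measurable_annulus.
    by move=> w; apply/idP/idP; rewrite !inE /annulus/= enormN.
  - exact: measurable_annulus.
  - by apply: integrableS iafe => //; [exact: measurable_annulus|move=> w /andP[]].
  - by apply: integrable_scale; [exact: measurable_annulus|exact: ifo].
have cv : pv_approx d (fun w => a * fe w + b * fo w) @ 0^'+ -->
    a * \int[leb]_(w in eball d) fe w.
  rewrite -RintegralZl//.
  have := cvg_pv_approx iafe; rewrite fe0 mulr0 => /(_ erefl).
  apply: cvg_trans; apply: near_eq_cvg.
  by near=> e; rewrite pvE//; near: e; exact: nbhs_right_gt.
(* For Fourier modes [b] varies with the point and may vanish, so either branch can occur. If the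
   sum converges absolutely, so does its odd part, by subtraction, and it integrates to 0 over the
   ball. *)
rewrite /ball_int_defined /ball_int; case: asboolP => [ac|nac].
  split; first by left.
  have ifo' : leb.-integrable (eball d) (EFin \o fo').
    have := integrableB mB ac iafe.
    apply: eq_integrable => // w _.
    by rewrite /= -EFinB addrC addKr.
  rewrite RintegralD// (@Rintegral_odd _ fo') ?addr0 ?RintegralZl//.
  by move=> w; apply/idP/idP; rewrite !inE /eball/= enormN.
split; last exact: cvg_lim.
right; split; last by apply/cvg_ex; exists (a * \int[leb]_(w in eball d) fe w).
move=> e /andP[e0 ed]; have mA := @measurable_annulus R n e d.
have iafe' : leb.-integrable (annulus e d) (EFin \o (fun w => a * fe w)).
  by apply: integrableS iafe => //; move=> w /andP[].
have := integrableD mA iafe' (integrable_scale mA b (ifo e e0)).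
by apply: eq_integrable => // w _; rewrite /= EFinD.
Unshelve. all: by end_near. Qed.

End principal_value.

(** * Fourier modes *)

Section fourier_modes.
Context {R : realType} {n : nat}.
Notation N := n.+1.
Notation leb := (lebesgue_cV N : {measure set 'cV[R]_N -> \bar R}).
Variables (d beta : R).
Hypotheses (d0 : 0 < d) (dim0 : beta < N%:R + 2).
Implicit Types (v w x y z nu : 'cV[R]_N) (i : 'I_N).

Let e_ i : 'cV[R]_N := delta_mx i ord0.

Lemma ReZr (a : R[i]) (r : R) : complex.Re (a * (r%:C)%C) = complex.Re a * r.
Proof. by case: a => p q /=; rewrite mulr0 subr0. Qed.

Lemma ImZr (a : R[i]) (r : R) : complex.Im (a * (r%:C)%C) = complex.Im a * r.
Proof. by case: a => p q /=; rewrite mulr0 add0r. Qed.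

Lemma cmx_mulmx_fourier (M : 'M[R]_N) nu z x i :
  (cmx M *m fourier_mode nu z x) i ord0 =
  expi (dotv nu x) * (((M *m z) i ord0)%:C)%C.
Proof. by rewrite /fourier_mode -scalemxAr /cmx -map_mxM !mxE. Qed.

Lemma tensor_mulmx v w z i : (tensor v w *m z) i ord0 = v i ord0 * dotv w z.
Proof.
rewrite mxE /dotv mulr_sumr; apply: eq_bigr => j _.
by rewrite /tensor mxE big_ord1 mxE mulrA.
Qed.

Lemma first_integrandE nu z x w i :
  first_integrand beta (fourier_mode nu z) x w i ord0 =
  (expi (dotv nu (x + w)) - expi (dotv nu x)) *
  ((dotv z w * dotv (e_ i) w / enorm w `^ (beta + 2))%:C)%C.
Proof.
rewrite /first_integrand mulmxBr mxE [in X in _ + X]mxE !cmx_mulmx_fourier -mulrBl.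
congr (_ * _); congr (_%:C)%C.
rewrite -scalemxAl mxE tensor_mulmx (dotvC (e_ i)) dotv_delta (dotvC z).
by ring.
Qed.

Lemma double_integrandE nu z x w q i :
  double_integrand beta (fourier_mode nu z) x w q i ord0 =
  expi (dotv nu (x + w) + dotv nu q) *
  ((dotv (e_ i) w / enorm w `^ beta * (dotv z q / enorm q `^ beta))%:C)%C.
Proof.
rewrite /double_integrand cmx_mulmx_fourier -dotvDr addrAC.
congr (_ * _); congr (_%:C)%C.
rewrite tensor_mulmx mxE dotvZl (dotvC (e_ i)) dotv_delta (dotvC q).
by ring.
Qed.

(** This and [odd_cos_integrand] are of order at most [|w|^(1 - beta)] at the origin, hence need not
    be integrable on the ball when [N + 1 <= beta]; they are estimated on annuli only. *)
Definition odd_sin_integrand nu z y w : R :=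
  sin (dotv nu w) * (dotv z w * dotv y w / enorm w `^ (beta + 2)).

Definition odd_cos_integrand nu y w : R :=
  cos (dotv nu w) * (dotv y w / enorm w `^ beta).

Lemma cos_integrand0 nu z y : cos_integrand beta nu z y 0 = 0.
Proof. by rewrite /cos_integrand (dotvC nu) dot0v cos0 subrr mul0r. Qed.

Lemma sin_integrand0 nu y : sin_integrand beta nu y 0 = 0.
Proof. by rewrite /sin_integrand (dotvC nu) dot0v sin0 mul0r. Qed.

Lemma odd_sinN nu z y w : odd_sin_integrand nu z y (- w) = - odd_sin_integrand nu z y w.
Proof. by rewrite /odd_sin_integrand !dotvN enormN sinN mulrNN mulNr. Qed.

Lemma odd_cosN nu y w : odd_cos_integrand nu y (- w) = - odd_cos_integrand nu y w.
Proof. by rewrite /odd_cos_integrand !dotvN enormN cosN mulNr mulrN. Qed.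

Let measurable_sin_dotv nu : measurable_fun setT (fun w => sin (dotv nu w)).
Proof.
apply: (measurableT_comp (f := sin)); last exact: measurable_dotv.
by apply: continuous_measurable_fun; exact: continuous_sin.
Qed.

Let measurable_cos_dotv nu : measurable_fun setT (fun w => cos (dotv nu w)).
Proof.
apply: (measurableT_comp (f := cos)); last exact: measurable_dotv.
by apply: continuous_measurable_fun; exact: continuous_cos.
Qed.

Let measurable_enormV a : measurable_fun setT (fun w => (enorm w `^ a)^-1).
Proof.
have := @measurable_weight R N 0 a; rewrite (_ : weight 0 a = fun w => (enorm w `^ a)^-1)//.
by apply/funext => w; rewrite /weight expr0 mul1r.
Qed.

Lemma measurable_odd_sin nu z y : measurable_fun setT (odd_sin_integrand nu z y).
Proof.
apply: measurable_funM => //; apply: measurable_funM => //.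
by apply: measurable_funM; exact: measurable_dotv.
Qed.

Lemma measurable_odd_cos nu y : measurable_fun setT (odd_cos_integrand nu y).
Proof.
apply: measurable_funM => //; apply: measurable_funM => //.
exact: measurable_dotv.
Qed.

Lemma integrable_odd_sin nu z y e : 0 < e ->
  leb.-integrable (annulus e d) (EFin \o odd_sin_integrand nu z y).
Proof.
move=> e0; apply: (integrable_annulus_le (j := 1) (a := beta + 2)
  (C := enorm z * enorm y) e0 (measurable_odd_sin nu z y)) => w _.
rewrite normrM -[leRHS]mul1r ler_pM ?sin_max// !normrM normfV.
rewrite (ger0_norm (powR_ge0 _ _)) /weight mulrA expr1 -sqr_enorm expr2 mulrACA.
rewrite ler_wpM2r ?invr_ge0 ?powR_ge0//; apply: ler_pM => //; exact: cauchy_schwarz.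
Qed.

Lemma integrable_odd_cos nu y e : 0 < e ->
  leb.-integrable (annulus e d) (EFin \o odd_cos_integrand nu y).
Proof.
move=> e0; apply: (integrable_annulus_le (j := 0) (a := beta)
  (C := enorm y * d) e0 (measurable_odd_cos nu y)) => w /andP[_ wd].
rewrite normrM -[leRHS]mul1r ler_pM ?cos_max// normrM normfV.
rewrite (ger0_norm (powR_ge0 _ _)) /weight expr0 mul1r.
rewrite ler_wpM2r ?invr_ge0 ?powR_ge0//; apply: le_trans (cauchy_schwarz _ _) _.
by apply: ler_wpM2l; [exact: enorm_ge0|exact: ltW].
Qed.

Let ball_int_cos nu z y (a b : R) :
  ball_int_defined d (fun w => a * cos_integrand beta nu z y w + b * odd_sin_integrand nu z y w) /\
  ball_int d (fun w => a * cos_integrand beta nu z y w + b * odd_sin_integrand nu z y w) =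
  a * \int[leb]_(w in eball d) cos_integrand beta nu z y w.
Proof.
apply: ball_int_even_odd.
- exact: cos_integrable.
- exact: cos_integrand0.
- exact: measurable_odd_sin.
- exact: odd_sinN.
- exact: integrable_odd_sin.
Qed.

Let ball_int_sin nu y (a b : R) :
  ball_int_defined d (fun w => a * sin_integrand beta nu y w + b * odd_cos_integrand nu y w) /\
  ball_int d (fun w => a * sin_integrand beta nu y w + b * odd_cos_integrand nu y w) =
  a * \int[leb]_(w in eball d) sin_integrand beta nu y w.
Proof.
apply: ball_int_even_odd.
- exact: sin_integrable.
- exact: sin_integrand0.
- exact: measurable_odd_cos.
- exact: odd_cosN.
- exact: integrable_odd_cos.
Qed.

Lemma Re_first_integrand nu z x i :
  (fun w => complex.Re (first_integrand beta (fourier_mode nu z) x w i ord0)) =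
  (fun w => cos (dotv nu x) * cos_integrand beta nu z (e_ i) w +
    - sin (dotv nu x) * odd_sin_integrand nu z (e_ i) w).
Proof.
apply/funext => w; rewrite first_integrandE ReZr raddfB /= dotvDr cosD.
rewrite /cos_integrand /odd_sin_integrand; ring.
Qed.

Lemma Im_first_integrand nu z x i :
  (fun w => complex.Im (first_integrand beta (fourier_mode nu z) x w i ord0)) =
  (fun w => sin (dotv nu x) * cos_integrand beta nu z (e_ i) w +
    cos (dotv nu x) * odd_sin_integrand nu z (e_ i) w).
Proof.
apply/funext => w; rewrite first_integrandE ImZr raddfB /= dotvDr sinD.
rewrite /cos_integrand /odd_sin_integrand; ring.
Qed.

Lemma vball_int_first nu z x :
  vball_int_defined d (first_integrand beta (fourier_mode nu z) x) /\
  vball_int d (first_integrand beta (fourier_mode nu z) x) =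
  \col_i (expi (dotv nu x) *
    ((\int[leb]_(w in eball d) cos_integrand beta nu z (e_ i) w)%:C)%C).
Proof.
split.
  move=> i; rewrite Re_first_integrand Im_first_integrand.
  by split; apply: (ball_int_cos nu z (e_ i) _ _).1.
apply/colP => i; rewrite !mxE Re_first_integrand Im_first_integrand.
rewrite !(ball_int_cos nu z (e_ i) _ _).2.
by apply/eqP; rewrite eq_complex /= mulr0 subr0 mulr0 add0r !eqxx.
Qed.

Lemma Re_double_integrand nu z x w i :
  (fun q => complex.Re (double_integrand beta (fourier_mode nu z) x w q i ord0)) =
  (fun q => - (dotv (e_ i) w / enorm w `^ beta * sin (dotv nu (x + w))) *
    sin_integrand beta nu z q +
    (dotv (e_ i) w / enorm w `^ beta * cos (dotv nu (x + w))) * odd_cos_integrand nu z q).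
Proof.
apply/funext => q; rewrite double_integrandE ReZr /= cosD.
rewrite /sin_integrand /odd_cos_integrand; ring.
Qed.

Lemma Im_double_integrand nu z x w i :
  (fun q => complex.Im (double_integrand beta (fourier_mode nu z) x w q i ord0)) =
  (fun q => (dotv (e_ i) w / enorm w `^ beta * cos (dotv nu (x + w))) *
    sin_integrand beta nu z q +
    (dotv (e_ i) w / enorm w `^ beta * sin (dotv nu (x + w))) * odd_cos_integrand nu z q).
Proof.
apply/funext => q; rewrite double_integrandE ImZr /= sinD.
rewrite /sin_integrand /odd_cos_integrand; ring.
Qed.

Lemma vball_int_inner_defined nu z x w :
  vball_int_defined d (double_integrand beta (fourier_mode nu z) x w).
Proof.
move=> i; rewrite Re_double_integrand Im_double_integrand.
by split; apply: (ball_int_sin nu z _ _).1.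
Qed.

Let S nu y := \int[leb]_(w in eball d) sin_integrand beta nu y w.

Lemma Re_vball_int_inner nu z x i :
  (fun w => complex.Re (vball_int d (double_integrand beta (fourier_mode nu z) x w) i ord0)) =
  (fun w => - (S nu z * cos (dotv nu x)) * sin_integrand beta nu (e_ i) w +
     - (S nu z * sin (dotv nu x)) * odd_cos_integrand nu (e_ i) w).
Proof.
apply/funext => w; rewrite mxE /= Re_double_integrand (ball_int_sin nu z _ _).2 -/(S nu z).
by rewrite dotvDr sinD /sin_integrand /odd_cos_integrand; move: (S _ _) => s; ring.
Qed.

Lemma Im_vball_int_inner nu z x i :
  (fun w => complex.Im (vball_int d (double_integrand beta (fourier_mode nu z) x w) i ord0)) =
  (fun w => - (S nu z * sin (dotv nu x)) * sin_integrand beta nu (e_ i) w +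
     (S nu z * cos (dotv nu x)) * odd_cos_integrand nu (e_ i) w).
Proof.
apply/funext => w; rewrite mxE /= Im_double_integrand (ball_int_sin nu z _ _).2 -/(S nu z).
by rewrite dotvDr cosD /sin_integrand /odd_cos_integrand; move: (S _ _) => s; ring.
Qed.

(** The inner principal value is the imaginary unit times [S nu z] times the mode at [x + w], so the
    outer integral has the same shape as the inner one. The two imaginary units multiply to the
    minus sign. *)
Lemma vball_int_double nu z x :
  vball_int_defined d (fun w => vball_int d (double_integrand beta (fourier_mode nu z) x w)) /\
  vball_int d (fun w => vball_int d (double_integrand beta (fourier_mode nu z) x w)) =
  \col_i (expi (dotv nu x) * ((- (S nu z * S nu (e_ i)))%:C)%C).
Proof.
split.
  move=> i; rewrite Re_vball_int_inner Im_vball_int_inner.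
  by split; apply: (ball_int_sin nu (e_ i) _ _).1.
apply/colP => i; rewrite mxE [in RHS]mxE Re_vball_int_inner Im_vball_int_inner.
rewrite !(ball_int_sin nu (e_ i) _ _).2 -!/(S nu (e_ i)).
apply/eqP; rewrite eq_complex /=; apply/andP; split; apply/eqP; ring.
Qed.

(** Both terms of the operator carry the factor [expi (dotv nu x)]; once it is removed, one real
    equation per coordinate remains, in which [x] no longer appears. *)
Lemma fourier_mode_eigen (mu lam l : R) nu z :
  (forall i, (N%:R + 2) * mu * @scaling_const R N d beta *
     \int[leb]_(w in eball d) cos_integrand beta nu z (e_ i) w -
     (lam - mu) * (@scaling_const R N d beta ^+ 2 / 4) * (S nu z * S nu (e_ i)) =
     l * z i ord0) ->
  peridynamic_eigen_eq d beta mu lam (fourier_mode nu z) l.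
Proof.
move=> h x; split.
  split; first exact: (vball_int_first nu z x).1.
  split; last exact: (vball_int_double nu z x).1.
  by move=> w _; exact: vball_int_inner_defined.
rewrite /peridynamic_op (vball_int_first nu z x).2 (vball_int_double nu z x).2.
apply/colP => i; rewrite !mxE.
rewrite [RHS](_ : _ = expi (dotv nu x) * ((l * z i ord0)%:C)%C); last first.
  by rewrite rmorphM /=; ring.
rewrite -h rmorphB (rmorphM _ (_ * _ * _)) (rmorphM _ ((lam - mu) * _)) (rmorphN _ (S _ _ * _)) /=.
move: (expi _) (_%:C)%C (_%:C)%C (_%:C)%C (_%:C)%C => X A B C D; ring.
Qed.

End fourier_modes.

(** * Modes on the torus and the eigenvalue theorem *)

Section torus.
Context {R : realType} {n : nat}.
Implicit Types (ell : 'I_n -> R) (k : 'cV[int]_n).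

Lemma expi_shift (t : R) (m : int) : expi (t + 2 * pi * m%:~R) = expi t.
Proof.
have natP (a : R) (p : nat) : expi (a + (pi *+ 2) *+ p) = expi a.
  by rewrite /expi (periodicn (@cosD2pi R)) (periodicn (@sinD2pi R)).
rewrite (_ : 2 * pi * m%:~R = (pi *+ 2) *~ m); last first.
  by rewrite mulrzr mulr_natl.
case: m => p; first exact: natP.
by rewrite NegzE mulrNz -[in RHS](subrK (pi *+ 2 *+ p.+1) t) natP.
Qed.

Lemma periodic_fourier_mode ell k (z : 'cV[R]_n) : (forall i, 0 < ell i) ->
  periodic_field ell (fourier_mode (freq ell k) z).
Proof.
move=> ell0 x i; rewrite /fourier_mode dotvDr dotvZr dotv_delta mxE.
by rewrite mulrC divfK ?gt_eqF// expi_shift.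
Qed.

Lemma fourier_mode_neq0 (nu z : 'cV[R]_n) : z != 0 -> exists x, fourier_mode nu z x != 0.
Proof.
move=> z0; exists 0; apply: contra z0 => /eqP h; apply/eqP/colP => i.
have := congr1 (fun u : 'cV[R[i]]_n => complex.Re (u i ord0)) h.
by rewrite /fourier_mode dotvC dot0v !mxE /= cos0 sin0 mul1r mul0r subr0.
Qed.

Lemma freq_neq0 ell k : (forall i, 0 < ell i) -> k != 0 -> freq ell k != 0.
Proof.
move=> ell0; apply: contra => /eqP h; apply/eqP/colP => i; rewrite mxE.
have := congr1 (fun u : 'cV[R]_n => u i ord0) h; rewrite !mxE => /eqP.
rewrite !mulf_eq0 invr_eq0 (gt_eqF (ell0 i)) orbF pnatr_eq0/= gt_eqF ?pi_gt0//=.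
by rewrite intr_eq0 => /eqP.
Qed.

End torus.

Theorem theorem3 (R : realType) (n : nat) (delta beta mu lam : R)
    (ell : 'I_n -> R) :
  (1 <= n)%N -> 0 < delta -> beta < n%:R + 2 -> (forall i, 0 < ell i) ->
  (forall k : 'cV[int]_n,
    [/\ peridynamic_eigen_eq delta beta mu lam
          (fourier_mode (freq ell k) (freq ell k))
          (lambda1 delta beta mu lam (freq ell k)),
        k != 0 ->
        peridynamic_eigenfield delta beta mu lam ell
          (fourier_mode (freq ell k) (freq ell k))
          (lambda1 delta beta mu lam (freq ell k))
      & forall zeta : 'I_n.-1 -> 'cV[R]_n,
          (forall j, zeta j != 0) ->
          (forall i j, i != j -> dotv (zeta i) (zeta j) = 0) ->
          (forall j, dotv (zeta j) (freq ell k) = 0) ->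
          forall j,
            peridynamic_eigenfield delta beta mu lam ell
              (fourier_mode (freq ell k) (zeta j))
              (lambda2 delta beta mu (freq ell k))]) /\
  (forall nu : 'cV[R]_n, nu != 0 ->
    [/\ abs_convergent delta (lambda1_integrand_cos beta nu),
        abs_convergent delta (lambda1_integrand_sin beta nu),
        abs_convergent delta (lambda2_integrand beta nu),
        lambda1 delta beta mu lam nu = lambda1_int delta beta mu lam nu
      & lambda2 delta beta mu nu = lambda2_int delta beta mu nu]).
Proof.
case: n ell => // n ell _ d0 dim0 ell0.
have eigen1 k : peridynamic_eigen_eq delta beta mu lam
    (fourier_mode (freq ell k) (freq ell k)) (lambda1 delta beta mu lam (freq ell k)).
  apply: fourier_mode_eigen => // i; set nu := freq ell k.
  have C := cos_parallel_value d0 dim0 nu (delta_mx i ord0).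
  have S1 := sin_value d0 dim0 nu nu.
  have S2 := sin_value d0 dim0 nu (delta_mx i ord0).
  rewrite dotv_delta in C S2.
  set X := \int[_]_(w in _) cos_integrand _ _ _ _ w in C *.
  set Y := \int[_]_(w in _) sin_integrand _ _ nu w in S1 *.
  set Z := \int[_]_(w in _) sin_integrand _ _ (delta_mx i ord0) w in S2 *.
  clearbody X Y Z.
  (* The factor [c^2 / 4] of the double integral is shared out as one [c / 2] for each sine
     integral, the form in which [sin_value] evaluates them. *)
  transitivity (mu * (- (3 * dotv nu nu * nu i ord0) *
      hypergeom [:: 1; 5 / 2; (n.+1%:R + 2 - beta) / 2]
        [:: 2; 3 / 2; (n.+1%:R + 4) / 2; (n.+1%:R + 4 - beta) / 2] (hyp_arg delta nu)) -
    (lam - mu) * ((dotv nu nu * hypergeom [:: (n.+1%:R + 2 - beta) / 2]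
      [:: (n.+1%:R + 2) / 2; (n.+1%:R + 4 - beta) / 2] (hyp_arg delta nu)) *
      (nu i ord0 * hypergeom [:: (n.+1%:R + 2 - beta) / 2]
      [:: (n.+1%:R + 2) / 2; (n.+1%:R + 4 - beta) / 2] (hyp_arg delta nu)))).
    by rewrite -C -S1 -S2; field.
  by rewrite /lambda1 sqr_enorm; ring.
split=> [k|nu nu0].
  split=> [//|k0|zeta zeta0 _ zetanu j]; first split=> //.
  - exact: periodic_fourier_mode.
  - exact/fourier_mode_neq0/freq_neq0.
  split; [exact: periodic_fourier_mode|exact: fourier_mode_neq0|].
  apply: fourier_mode_eigen => // i; set nu := freq ell k.
  have nuz : dotv nu (zeta j) = 0 by rewrite dotvC.
  have C := cos_orthogonal_value d0 dim0 (delta_mx i ord0) nuz.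
  have S1 := sin_value d0 dim0 nu (zeta j).
  (* For a transverse amplitude the normalized inner sine integral is 0, so the term with [lam - mu]
     drops out. *)
  rewrite dotv_delta in C; rewrite nuz mul0r in S1.
  set X := \int[_]_(w in _) cos_integrand _ _ _ _ w in C *.
  set Y := \int[_]_(w in _) sin_integrand _ _ (zeta j) w in S1 *.
  set Z := \int[_]_(w in _) sin_integrand _ _ (delta_mx i ord0) w.
  clearbody X Y Z.
  transitivity (mu * (- (dotv nu nu * zeta j i ord0) *
      hypergeom [:: 1; (n.+1%:R + 2 - beta) / 2]
        [:: 2; (n.+1%:R + 4) / 2; (n.+1%:R + 4 - beta) / 2] (hyp_arg delta nu)) -
    (lam - mu) * (0 * (@scaling_const R n.+1 delta beta / 2 * Z))).
    by rewrite -C -S1; field.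
  by rewrite /lambda2 sqr_enorm; ring.
have mB := @measurable_eball R n.+1 delta.
have e0 : enorm nu != 0 by rewrite enorm_eq0.
(* For [nu != 0] the integrands of the integral formulas are the even parts in direction [nu] and
   the sine remainder, divided by a power of [|nu|]; their integrability and values are already
   available. *)
have cosE : lambda1_integrand_cos beta nu =
    fun w => (enorm nu ^+ 2)^-1 * cos_integrand beta nu nu nu w.
  apply/funext => w; rewrite /lambda1_integrand_cos /cos_integrand invfM expr2; ring.
have sinE : lambda1_integrand_sin beta nu =
    fun w => (enorm nu)^-1 * sin_integrand beta nu nu w.
  apply/funext => w; rewrite /lambda1_integrand_sin /sin_integrand invfM; ring.
have sin_subidE : lambda2_integrand beta nu =
    fun w => (enorm nu ^+ 2)^-1 * sin_subid_integrand beta nu w.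
  apply/funext => w; rewrite /lambda2_integrand /sin_subid_integrand invfM; ring.
have iC := cos_integrable d0 dim0 nu nu nu.
have iS := sin_integrable d0 dim0 nu nu.
have iD := sin_subid_integrable d0 dim0 nu.
split.
- by rewrite cosE; exact: integrable_scale.
- by rewrite sinE; exact: integrable_scale.
- by rewrite sin_subidE; exact: integrable_scale.
- rewrite /lambda1_int cosE sinE RintegralZl// RintegralZl//.
  have := cos_parallel_value d0 dim0 nu nu; have := sin_value d0 dim0 nu nu.
  move: (Rintegral _ _ _) (Rintegral _ _ _) => X Y; rewrite -sqr_enorm => S C.
  transitivity (mu * (enorm nu ^+ 2)^-1 * ((n.+1%:R + 2) * @scaling_const R n.+1 delta beta * X) -
      (lam - mu) * ((enorm nu)^-1 * (@scaling_const R n.+1 delta beta / 2 * Y)) ^+ 2).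
    by rewrite C S /lambda1; field.
  by ring.
- rewrite /lambda2_int sin_subidE RintegralZl//.
  have := sin_subid_value d0 dim0 nu; move: (Rintegral _ _ _) => X.
  rewrite -sqr_enorm => C.
  transitivity (mu * (enorm nu ^+ 2)^-1 * ((n.+1%:R + 2) * @scaling_const R n.+1 delta beta * X)).
    by rewrite C /lambda2; field.
  by ring.
Qed.
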